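(* Let $A$ be a unital C*-algebra with stable rank one. Let $\alpha \colon G \to \operatorname{Aut}(A)$ be an action of a finite group $G$ on $A$ which has the Rokhlin property. Then the inclusion map $\iota \colon A^{\alpha} \to A$ induces an isomorphism of ordered semigroups $\operatorname{W}(\iota) \colon \operatorname{W}(A^{\alpha}) \to \operatorname{W}(A)^{\alpha}$.
   Context: $A^{\alpha} = \{a \in A : \alpha_g(a) = a \text{ for all } g \in G\}$ is the fixed point algebra. A unital C*-algebra has stable rank one if its invertible elements are dense. $M_\infty(B) = \bigcup_n M_n(B)$ (with $a \mapsto \operatorname{diag}(a,0)$). For a C*-algebra $B$ and $a,b \in M_\infty(B)_+$, write $a \precsim_B b$ if there is a sequence $(v_n)$ in $M_\infty(B)$ with $\lim_n v_n b v_n^* = a$, and $a \sim_B b$ if $a \precsim_B b$ and $b \precsim_B a$; $\langle a \rangle_B$ is the $\sim_B$-class of $a$. $\operatorname{W}(B) = M_\infty(B)_+/\!\sim_B$, with addition $\langle a\rangle_B + \langle b\rangle_B = \langle a \oplus b\rangle_B$ and order $\langle a\rangle_B \le \langle b\rangle_B$ iff $a \precsim_B b$. A homomorphism $\varphi\colon A \to B$ induces $\operatorname{W}(\varphi)(\langle a\rangle_A) = \langle\varphi(a)\rangle_B$ (with $\varphi$ amplified to matrices). $G$ acts on $\operatorname{W}(A)$ via the maps $\operatorname{W}(\alpha_g)$, and $\operatorname{W}(A)^\alpha$ is the set of elements fixed by this action. Rokhlin property (standard definition): an action $\alpha\colon G\to\operatorname{Aut}(A)$ of a finite group on a unital C*-algebra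 has the Rokhlin property if for every finite $F\subseteq A$ and $\varepsilon>0$ there are mutually orthogonal projections $e_g\in A$, $g\in G$, with $\|\alpha_g(e_h)-e_{gh}\|<\varepsilon$ for all $g,h \in G$, $\|e_g a - a e_g\|<\varepsilon$ for all $g\in G$, $a\in F$, and $\sum_{g\in G}e_g=1$. *)

(* Defs.v *)
From HB Require Import structures.
From mathcomp Require Import all_boot all_order all_algebra all_fingroup.
From mathcomp Require Import complex.
From mathcomp Require Import boolp classical_sets functions cardinality reals.
From mathcomp Require Import topology normedtype sequences.
From mathcomp Require Import ring lra.

Set Implicit Arguments.
Unset Strict Implicit.
Unset Printing Implicit Defensive.

Import Order.TTheory GRing.Theory Num.Theory.
Import numFieldNormedType.Exports.

Local Open Scope classical_set_scope.
Local Open Scope ring_scope.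
Local Open Scope complex_scope.

(* Unit and product are part of this mixin because the hierarchy has no join of
   normed modules and noncommutative rings; the [pzRingType] structure is
   attached to every C*-algebra just below.  The zero algebra, with [1 = 0], is
   allowed. *)
HB.mixin Record isUnitalCStarAlgebra (R : realType) A
    of CompleteNormedModule R[i] A := {
  cstar_one : A;
  cstar_mul : A -> A -> A;
  star : A -> A;
  cstar_mulA : associative cstar_mul;
  cstar_mul1 : left_id cstar_one cstar_mul;
  cstar_mulr1 : right_id cstar_one cstar_mul;
  cstar_mulDl : left_distributive cstar_mul +%R;
  cstar_mulDr : right_distributive cstar_mul +%R;
  cstar_scaleAl : forall (c : R[i]) (x y : A),
    c *: cstar_mul x y = cstar_mul (c *: x) y;
  cstar_scaleAr : forall (c : R[i]) (x y : A),
    c *: cstar_mul x y = cstar_mul x (c *: y);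
  cstar_normM : forall x y : A, `|cstar_mul x y| <= `|x| * `|y|;
  starK : involutive star;
  starD : {morph star : x y / x + y};
  starZ : forall (c : R[i]) (x : A), star (c *: x) = (c^*)%C *: star x;
  starM_subproof : forall x y : A,
    star (cstar_mul x y) = cstar_mul (star y) (star x);
  cstar_id_subproof : forall x : A, `|cstar_mul (star x) x| = `|x| ^+ 2
}.

#[short(type="unitalCStarAlgType")]
HB.structure Definition UnitalCStarAlgebra (R : realType) :=
  {A of isUnitalCStarAlgebra R A & CompleteNormedModule R[i] A}.

#[non_forgetful_inheritance]
HB.instance Definition _ (R : realType) (A : unitalCStarAlgType R) :=
  GRing.Zmodule_isPzRing.Build (UnitalCStarAlgebra.sort A)
    cstar_mulA cstar_mul1 cstar_mulr1 cstar_mulDl cstar_mulDr.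

Section StarTheory.
Context {R : realType} {A : unitalCStarAlgType R}.
Implicit Types x y : A.

Lemma starM x y : star (x * y) = star y * star x.
Proof. exact: starM_subproof. Qed.

Lemma cstar_id x : `|star x * x| = `|x| ^+ 2.
Proof. exact: cstar_id_subproof. Qed.

Lemma norm_mul_le x y : `|x * y| <= `|x| * `|y|.
Proof. exact: cstar_normM. Qed.

Lemma scale_mulAl (c : R[i]) x y : c *: (x * y) = (c *: x) * y.
Proof. exact: cstar_scaleAl. Qed.

Lemma scale_mulAr (c : R[i]) x y : c *: (x * y) = x * (c *: y).
Proof. exact: cstar_scaleAr. Qed.

Lemma star0 : star (0 : A) = 0.
Proof. by have := starZ 0 (0 : A); rewrite scale0r conjc0 scale0r. Qed.

Lemma starN x : star (- x) = - star x.
Proof. by apply/eqP; rewrite -subr_eq0 opprK -starD addNr star0. Qed.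

Lemma starB x y : star (x - y) = star x - star y.
Proof. by rewrite starD starN. Qed.

Lemma star1 : star (1 : A) = 1.
Proof. by rewrite -[RHS]starK -[star 1 in RHS]mulr1 starM starK mulr1. Qed.

Lemma norm_star x : `|star x| = `|x|.
Proof.
suff H y : `|y| <= `|star y|.
  by apply/eqP; rewrite eq_le H -{2}[x]starK H.
have := norm_mul_le (star y) y; rewrite cstar_id expr2.
have [->|y0] := eqVneq `|y| 0; first by [].
by rewrite ler_pM2r// lt_neqAle eq_sym y0 normr_ge0.
Qed.

End StarTheory.

Section CNorm.
Context {R : realType} {A : unitalCStarAlgType R}.
Implicit Types x y : A.

(* The norm of a normed module over R[i] takes its values in R[i]. *)
Definition cnorm x : R := complex.Re `|x|.

Lemma real_complexI (r s : R) : r%:C = s%:C -> r = s.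
Proof. by case. Qed.

Lemma cnormE x : `|x| = (cnorm x)%:C.
Proof. by rewrite /cnorm (RRe_real (ger0_real (normr_ge0 x))). Qed.

Lemma cnorm_ge0 x : 0 <= cnorm x.
Proof. by rewrite -lecR -cnormE; exact: (normr_ge0 x). Qed.

Lemma cnorm0 : cnorm (0 : A) = 0.
Proof. by rewrite /cnorm normr0. Qed.

Lemma cnorm0_eq0 x : cnorm x = 0 -> x = 0.
Proof. by move=> x0; apply/normr0_eq0; rewrite cnormE x0. Qed.

Lemma cnormD x y : cnorm (x + y) <= cnorm x + cnorm y.
Proof. by rewrite -lecR rmorphD/= -!cnormE ler_normD. Qed.

Lemma cnormN x : cnorm (- x) = cnorm x.
Proof. by rewrite /cnorm normrN. Qed.

Lemma cnormB x y : cnorm (x - y) <= cnorm x + cnorm y.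
Proof. by rewrite -(cnormN y) cnormD. Qed.

Lemma cdistC x y : cnorm (x - y) = cnorm (y - x).
Proof. by rewrite /cnorm distrC. Qed.

Lemma cnormM x y : cnorm (x * y) <= cnorm x * cnorm y.
Proof. by rewrite -lecR rmorphM/= -!cnormE norm_mul_le. Qed.

Lemma cnormZ (c : R) x : 0 <= c -> cnorm (c%:C *: x) = c * cnorm x.
Proof.
move=> c0; apply: real_complexI; rewrite rmorphM/= -!cnormE normrZ.
by rewrite ger0_norm// lecR.
Qed.

Lemma cnorm_star x : cnorm (star x) = cnorm x.
Proof. by rewrite /cnorm norm_star. Qed.

Lemma cnorm_id x : cnorm (star x * x) = cnorm x ^+ 2.
Proof.
by apply: real_complexI; rewrite rmorphXn/= -!cnormE cstar_id.
Qed.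

Lemma cnorm_eps0 x (K : R) :
  (forall e : R, 0 < e -> e <= 1 -> cnorm x <= K * e) -> x = 0.
Proof.
move=> H; apply: cnorm0_eq0; apply/eqP; rewrite eq_le cnorm_ge0 andbT leNgt.
apply/negP => x0.
have K0 : 0 < K by have := H 1 ltr01 (lexx _); lra.
have e0 : 0 < cnorm x / (2 * K) by rewrite divr_gt0// mulr_gt0.
have [e1|e1] := leP (cnorm x / (2 * K)) 1.
  have := H _ e0 e1.
  suff -> : K * (cnorm x / (2 * K)) = cnorm x / 2 by lra.
  by field; lra.
have := H 1 ltr01 (lexx _).
by move: e1; rewrite ltr_pdivlMr; lra.
Qed.

Lemma cnorm_cvg (y_ : nat -> A) :
  (forall n m, cnorm (y_ (n + m)%N - y_ n) <= 2^-1 ^+ n) ->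
  exists y, forall e : R, 0 < e ->
    exists n, cnorm (y - y_ n) <= e /\ cnorm (y - y_ n.+1) <= e.
Proof.
move=> ycau.
have pow0 (e : R) : 0 < e -> \forall n \near \oo, 2^-1 ^+ n < e.
  move=> e0; have /cvgrPdist_lt /(_ e e0) : (2^-1 : R) ^+ n @[n --> \oo] --> 0.
    by apply: cvg_expr; rewrite ger0_norm; lra.
  apply: filterS => n; rewrite sub0r normrN ger0_norm//.
  by rewrite exprn_ge0//; lra.
have : cvg (y_ @ \oo).
  apply: cauchy_cvg; apply/cauchyP => e e0.
  have e0' : 0 < complex.Re e by move: e0; rewrite ltcE => /andP[_].
  have eE : e = (complex.Re e)%:C by rewrite RRe_real// gtr0_real.
  have [N _ HN] := pow0 _ e0'.
  exists (y_ N); exists N => // m /= Nm.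
  rewrite -ball_normE /ball_ /= cnormE eE ltcR cdistC.
  by rewrite -(subnKC Nm) (le_lt_trans (ycau _ _))// HN/=.
move=> /cvg_ex[y /cvgrPdist_lt yy]; exists y => e e0.
have [|N _ HN] := yy e%:C; first by rewrite ltcR.
by exists N; rewrite -!lecR -!cnormE; split; apply/ltW/HN => /=.
Qed.

Lemma half_half (x : A) : 2^-1%:C *: x + 2^-1%:C *: x = x.
Proof.
rewrite -scalerDl -rmorphD/= -[RHS]scale1r; congr (_ *: _).
by rewrite -[RHS]/((1 : R)%:C); congr (_%:C); lra.
Qed.

(* Square root of [1 - h ^+ 2], as the fixed point of
   [y |-> (h ^+ 2 + y ^+ 2) / 2]. *)
Lemma cstar_sqrt_sub (h : A) : star h = h -> cnorm h <= 2^-1 ->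
  exists2 k : A, star k = k & k * h = h * k /\ h * h + k * k = 1.
Proof.
move=> hsa h12.
have h0 := cnorm_ge0 h.
pose f (y : A) : A := 2^-1%:C *: (h * h + y * y).
pose y_ n := iter n f 0.
have fbd y : cnorm y <= 2^-1 -> cnorm (f y) <= 2^-1.
  move=> y12; rewrite cnormZ; last lra.
  have := cnormD (h * h) (y * y); have := cnormM h h; have := cnormM y y.
  by have := cnorm_ge0 y; nra.
have fctr y z : cnorm y <= 2^-1 -> cnorm z <= 2^-1 ->
    cnorm (f y - f z) <= 2^-1 * cnorm (y - z).
  move=> y12 z12; rewrite /f -scalerBr cnormZ; last lra.
  rewrite opprD addrACA subrr add0r.
  have -> : y * y - z * z = y * (y - z) + (y - z) * z.
    by rewrite mulrBr mulrBl addrA subrK.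
  have := cnormD (y * (y - z)) ((y - z) * z).
  have := cnormM y (y - z); have := cnormM (y - z) z.
  by have := cnorm_ge0 y; have := cnorm_ge0 z; have := cnorm_ge0 (y - z); nra.
have ybd n : cnorm (y_ n) <= 2^-1.
  by elim: n => [|n IH]; [rewrite cnorm0; lra | exact: fbd].
have ycau n m : cnorm (y_ (n + m)%N - y_ n) <= 2^-1 ^+ n.
  elim: n => [|n IH].
    by rewrite add0n subr0 expr0 (le_trans (ybd m))//; lra.
  rewrite addSn /y_ !iterS -!/(y_ _) exprS.
  apply: le_trans (fctr _ _ (ybd _) (ybd _)) _.
  by apply: ler_wpM2l => //; lra.
have ysa n : star (y_ n) = y_ n.
  elim: n => [|n IH]; first exact: star0.
  rewrite /y_ iterS -/(y_ n) /f starZ starD !starM hsa IH.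
  by rewrite conjc_real.
have ycom n : y_ n * h = h * y_ n.
  elim: n => [|n IH]; first by rewrite mul0r mulr0.
  rewrite /y_ iterS -/(y_ n) /f -scale_mulAl -scale_mulAr mulrDl mulrDr.
  by rewrite -!mulrA IH [y_ n * (h * _)]mulrA IH -mulrA.
have [y yy] := cnorm_cvg ycau.
have ystar : star y = y.
  apply/eqP; rewrite -subr_eq0; apply/eqP/(@cnorm_eps0 _ 2) => e e0 e1.
  have [n [yn _]] := yy e e0.
  have -> : star y - y = star (y - y_ n) - (y - y_ n).
    by rewrite starB ysa opprB addrA subrK.
  have := cnormB (star (y - y_ n)) (y - y_ n).
  by rewrite cnorm_star; lra.
have ycomh : y * h = h * y.
  apply/eqP; rewrite -subr_eq0; apply/eqP/(@cnorm_eps0 _ 1) => e e0 e1.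
  have [n [yn _]] := yy e e0.
  have -> : y * h - h * y = (y - y_ n) * h - h * (y - y_ n).
    by rewrite mulrBl mulrBr ycom opprB addrA subrK.
  have := cnormB ((y - y_ n) * h) (h * (y - y_ n)).
  have := cnormM (y - y_ n) h; have := cnormM h (y - y_ n).
  by have := cnorm_ge0 (y - y_ n); nra.
have yfix : y = f y.
  apply/eqP; rewrite -subr_eq0; apply/eqP/(@cnorm_eps0 _ 3) => e e0 e1.
  have [n [yn yn1]] := yy e e0.
  have -> : y - f y = (y - y_ n.+1) + (f (y_ n) - f y).
    by rewrite /y_ iterS addrA subrK.
  have := cnormD (y - y_ n.+1) (f (y_ n) - f y).
  suff : cnorm (f (y_ n) - f y) <= 2 * e by lra.
  rewrite /f -scalerBr cnormZ; last lra.
  rewrite opprD addrACA subrr add0r.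
  have -> : y_ n * y_ n - y * y = y_ n * (y_ n - y) + (y_ n - y) * y.
    by rewrite mulrBr mulrBl addrA subrK.
  have := cnormD (y_ n * (y_ n - y)) ((y_ n - y) * y).
  have := cnormM (y_ n) (y_ n - y); have := cnormM (y_ n - y) y.
  have := cnormD (y - y_ n) (y_ n); rewrite subrK cdistC.
  rewrite cdistC in yn.
  have := cnorm_ge0 (y_ n - y); have := ybd n.
  by have := cnorm_ge0 y; have := cnorm_ge0 (y_ n); nra.
have y2 : y + y = h * h + y * y.
  by rewrite [in LHS]yfix /f half_half.
exists (1 - y); first by rewrite starB star1 ystar.
split; first by rewrite mulrBl mulrBr mul1r mulr1 ycomh.
rewrite mulrBr mulr1 mulrBl mul1r opprB.
have -> : h * h = y + y - y * y by rewrite y2 addrK.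
by rewrite addrACA addKr addrCA !addrK.
Qed.

End CNorm.

Record starHom (R : realType) (A B : unitalCStarAlgType R) := StarHom {
  starhom_fun :> A -> B;
  starhom_linear : linear starhom_fun;
  starhomM : forall x y, starhom_fun (x * y) = starhom_fun x * starhom_fun y;
  starhomS : forall x, starhom_fun (star x) = star (starhom_fun x)
}.

(* Each [alpha g] is an automorphism: its inverse is [alpha g^-1]. *)
Record cstarAction (R : realType) (gT : finGroupType)
    (A : unitalCStarAlgType R) := CStarAction {
  action_hom :> gT -> starHom A A;
  action1 : forall x, action_hom 1%g x = x;
  actionM : forall g h x, action_hom (g * h)%g x = action_hom g (action_hom h x)
}.

(* Automatic continuity of *-homomorphisms: it makes the fixed point algebra
   closed, hence complete. *)
Section StarHomContinuous.
Context {R : realType} {A B : unitalCStarAlgType R} (phi : starHom A B).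

HB.instance Definition _ :=
  GRing.isLinear.Build R[i] A B _ (starhom_fun phi) (starhom_linear phi).

Lemma starhom_bounded x : cnorm (phi x) <= 2 * cnorm x.
Proof.
have sa12 (h : A) : star h = h -> cnorm h <= 2^-1 -> cnorm (phi h) <= 1.
  move=> hsa h12; have [k ksa [kh hk]] := cstar_sqrt_sub hsa h12.
  have conji : (('i : R[i])^*)%C = - 'i%C.
    by apply/eqP; rewrite eq_complex/= oppr0 !eqxx.
  have sqri : 'i%C * 'i%C = -1 :> R[i] by rewrite -expr2 sqr_i.
  pose u := phi h + 'i%C *: phi k.
  have su : star u = phi h - 'i%C *: phi k.
    by rewrite starD starZ -!starhomS hsa ksa conji scaleNr.
  have uu : star u * u = phi 1.
    rewrite su /u mulrDr !mulrBl -!scale_mulAl -!scale_mulAr -!starhomM kh.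
    rewrite !scalerA sqri scaleN1r.
    by rewrite opprK addrA subrK -hk raddfD.
  have p1 : cnorm (phi 1) <= 1.
    have : cnorm (phi 1) = cnorm (phi 1) ^+ 2.
      by rewrite -cnorm_id -starhomS star1 -starhomM mulr1.
    by have := cnorm_ge0 (phi 1); nra.
  have u1 : cnorm u <= 1.
    by have := cnorm_id u; rewrite uu; have := cnorm_ge0 u; nra.
  have -> : phi h = 2^-1%:C *: (u + star u).
    by rewrite su /u addrACA subrr addr0 scalerDr half_half.
  rewrite cnormZ; last lra.
  by have := cnormD u (star u); rewrite cnorm_star; lra.
have sa (h : A) : star h = h -> cnorm (phi h) <= 2 * cnorm h.
  move=> hsa; have [h0|h0] := eqVneq (cnorm h) 0.
    by rewrite (cnorm0_eq0 h0) raddf0 !cnorm0 mulr0.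
  have hp : 0 < cnorm h by rewrite lt_neqAle eq_sym h0 cnorm_ge0.
  pose c := (2 * cnorm h)^-1.
  have c0 : 0 < c by rewrite invr_gt0; lra.
  have cN : c * cnorm h = 2^-1 by rewrite /c invfM -mulrA mulVf ?mulr1.
  have c0' := ltW c0.
  have csa : star (c%:C *: h) = c%:C *: h by rewrite starZ hsa conjc_real.
  have := sa12 _ csa; rewrite linearZ/= !cnormZ// cN => /(_ (lexx _)).
  by rewrite /c mulrC ler_pdivrMr ?mul1r//; lra.
have := sa (star x * x); rewrite starM starK => /(_ erefl).
rewrite starhomM starhomS !cnorm_id.
by have := cnorm_ge0 x; have := cnorm_ge0 (phi x); nra.
Qed.

End StarHomContinuous.

Section FixedPointAlgebra.
Context {R : realType} {gT : finGroupType} {A : unitalCStarAlgType R}.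
Variable alpha : cstarAction gT A.

Lemma action_hom1 g : alpha g 1 = 1.
Proof.
have gK x : alpha g (alpha g^-1%g x) = x by rewrite -actionM mulgV action1.
by rewrite -[LHS]mulr1 -[X in _ * X]gK -starhomM mul1r gK.
Qed.

Definition fixed_pred : {pred A} := fun a => [forall g, alpha g a == a].

Record fixedAlg := FixedAlg { fixed_val :> A; _ : fixed_val \in fixed_pred }.

Lemma fixedP a : reflect (forall g, alpha g a = a) (a \in fixed_pred).
Proof.
by apply: (iffP forallP) => [H g|H g]; [exact/eqP/H | apply/eqP/H].
Qed.

Fact fixed_subring : subring_closed fixed_pred.
Proof.
split=> [|a b /fixedP Ha /fixedP Hb|a b /fixedP Ha /fixedP Hb];
  apply/fixedP => g.
- exact: action_hom1.
- by rewrite raddfB/= Ha Hb.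
- by rewrite starhomM Ha Hb.
Qed.

Fact fixed_zmod : zmod_closed fixed_pred.
Proof.
split=> [|a b aP bP]; first by apply/fixedP => g; rewrite raddf0.
by case: fixed_subring => _ subP _; exact: subP.
Qed.

Fact fixed_submod : subsemimod_closed fixed_pred.
Proof.
split; first exact: GRing.zmod_closedD fixed_zmod.
by move=> c a /fixedP Ha; apply/fixedP => g; rewrite linearZ/= Ha.
Qed.

Fact fixed_star a : a \in fixed_pred -> star a \in fixed_pred.
Proof. by move=> /fixedP Ha; apply/fixedP => g; rewrite starhomS Ha. Qed.

HB.instance Definition _ := [isSub for fixed_val].
HB.instance Definition _ := [Choice of fixedAlg by <:].
HB.instance Definition _ :=
  GRing.SubChoice_isSubZmodule.Build A fixed_pred fixedAlg fixed_zmod.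
HB.instance Definition _ :=
  GRing.SubZmodule_isSubLmodule.Build R[i] A fixed_pred fixedAlg fixed_submod.

Let fixed_norm (a : fixedAlg) : R[i] := `|fixed_val a|.

Fact fixed_normD (a b : fixedAlg) :
  fixed_norm (a + b) <= fixed_norm a + fixed_norm b.
Proof. exact: ler_normD. Qed.

Fact fixed_normZ (c : R[i]) (a : fixedAlg) :
  fixed_norm (c *: a) = `|c| * fixed_norm a.
Proof. exact: normrZ. Qed.

Fact fixed_norm0 (a : fixedAlg) : fixed_norm a = 0 -> a = 0.
Proof. by move=> a0; apply/val_inj/normr0_eq0. Qed.

HB.instance Definition _ :=
  Lmodule_isNormed.Build R[i] fixedAlg fixed_normD fixed_normZ fixed_norm0.

Fact fixed_complete (F : set_system fixedAlg) :
  ProperFilter F -> cauchy F -> cvg F.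
Proof.
move=> FF /cauchyP Fc.
pose G : set_system A := fixed_val @ F.
have Gc : cauchy G.
  apply/cauchyP => e e0; have [a Fa] := Fc e e0.
  exists (fixed_val a); suff : F (fixed_val @^-1` ball (fixed_val a) e) by [].
  by move: Fa; apply: filterS => b; rewrite -!ball_normE.
have GF : ProperFilter G by exact: fmap_proper_filter.
have /cvg_ex[a Ga] := @cauchy_cvg A G GF Gc.
have aP : a \in fixed_pred.
  apply/fixedP => g; apply/eqP; rewrite -subr_eq0; apply/eqP.
  apply: (@cnorm_eps0 _ _ _ 3) => e e0 e1.
  have eC : 0 < e%:C by rewrite ltcR.
  have /cvgrPdist_lt /(_ _ eC) /= /filter_ex[b] := Ga.
  have /fixedP/(_ g) bP := valP b.
  rewrite cnormE ltcR => ab.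
  have -> : alpha g a - a = alpha g (a - fixed_val b) - (a - fixed_val b).
    by rewrite raddfB/= bP opprB addrA subrK.
  have := cnormB (alpha g (a - fixed_val b)) (a - fixed_val b).
  by have := starhom_bounded (alpha g) (a - fixed_val b); lra.
apply/cvg_ex; exists (FixedAlg aP); apply/cvgrPdist_lt => e e0.
by have /cvgrPdist_lt /(_ _ e0) := Ga.
Qed.

HB.instance Definition _ := Uniform_isComplete.Build fixedAlg fixed_complete.

Fact fixed_one_subproof : 1 \in fixed_pred.
Proof. by case: fixed_subring. Qed.

Let fixed_one : fixedAlg := FixedAlg fixed_one_subproof.

Fact fixed_mul_subproof (a b : fixedAlg) :
  fixed_val a * fixed_val b \in fixed_pred.
Proof. by case: fixed_subring => _ _; apply; exact: valP. Qed.

Let fixed_mul (a b : fixedAlg) : fixedAlg :=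
  FixedAlg (fixed_mul_subproof a b).
Let fixed_starf (a : fixedAlg) : fixedAlg := FixedAlg (fixed_star (valP a)).

Fact fixed_mulA : associative fixed_mul.
Proof. by move=> a b c; apply: val_inj; exact: mulrA. Qed.

Fact fixed_mul1 : left_id fixed_one fixed_mul.
Proof. by move=> a; apply: val_inj; exact: mul1r. Qed.

Fact fixed_mulr1 : right_id fixed_one fixed_mul.
Proof. by move=> a; apply: val_inj; exact: mulr1. Qed.

Fact fixed_mulDl : left_distributive fixed_mul +%R.
Proof. by move=> a b c; apply: val_inj; exact: mulrDl. Qed.

Fact fixed_mulDr : right_distributive fixed_mul +%R.
Proof. by move=> a b c; apply: val_inj; exact: mulrDr. Qed.

Fact fixed_scaleAl (c : R[i]) (a b : fixedAlg) :
  c *: fixed_mul a b = fixed_mul (c *: a) b.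
Proof. by apply: val_inj; exact: scale_mulAl. Qed.

Fact fixed_scaleAr (c : R[i]) (a b : fixedAlg) :
  c *: fixed_mul a b = fixed_mul a (c *: b).
Proof. by apply: val_inj; exact: scale_mulAr. Qed.

Fact fixed_normM (a b : fixedAlg) : `|fixed_mul a b| <= `|a| * `|b|.
Proof. exact: norm_mul_le. Qed.

Fact fixed_starK : involutive fixed_starf.
Proof. by move=> a; apply: val_inj; exact: starK. Qed.

Fact fixed_starD : {morph fixed_starf : a b / a + b}.
Proof. by move=> a b; apply: val_inj; exact: starD. Qed.

Fact fixed_starZ (c : R[i]) (a : fixedAlg) :
  fixed_starf (c *: a) = (c^*)%C *: fixed_starf a.
Proof. by apply: val_inj; exact: starZ. Qed.

Fact fixed_starM (a b : fixedAlg) :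
  fixed_starf (fixed_mul a b) = fixed_mul (fixed_starf b) (fixed_starf a).
Proof. by apply: val_inj; exact: starM. Qed.

Fact fixed_cstar_id (a : fixedAlg) :
  `|fixed_mul (fixed_starf a) a| = `|a| ^+ 2.
Proof. exact: cstar_id. Qed.

HB.instance Definition _ := isUnitalCStarAlgebra.Build R fixedAlg
  fixed_mulA fixed_mul1 fixed_mulr1 fixed_mulDl fixed_mulDr
  fixed_scaleAl fixed_scaleAr fixed_normM
  fixed_starK fixed_starD fixed_starZ fixed_starM fixed_cstar_id.

HB.instance Definition _ :=
  GRing.PzRing.copy fixedAlg (fixedAlg : unitalCStarAlgType R).

Fact fixed_val_linear : linear fixed_val. Proof. by []. Qed.

Fact fixed_valM (a b : fixedAlg) :
  fixed_val (a * b) = fixed_val a * fixed_val b.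
Proof. by []. Qed.

Fact fixed_valS (a : fixedAlg) : fixed_val (star a) = star (fixed_val a).
Proof. by []. Qed.

Definition fixed_incl : starHom fixedAlg A :=
  StarHom fixed_val_linear fixed_valM fixed_valS.

End FixedPointAlgebra.

Definition stable_rank_one {R : realType} (A : unitalCStarAlgType R) : Prop :=
  dense [set x : A | exists y : A, x * y = 1 /\ y * x = 1].

Definition is_projection {R : realType} {A : unitalCStarAlgType R} (e : A) :=
  star e = e /\ e * e = e.

Definition rokhlin_property {R : realType} {gT : finGroupType}
    {A : unitalCStarAlgType R} (alpha : cstarAction gT A) : Prop :=
  forall (F : set A) (eps : R), finite_set F -> 0 < eps ->
  exists e : gT -> A,
    [/\ forall g, is_projection (e g),
        forall g h, g != h -> e g * e h = 0,
        forall g h, cnorm (alpha g (e h) - e (g * h)%g) < eps,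
        forall g a, F a -> cnorm (e g * a - a * e g) < eps
      & \sum_g e g = 1].

Section MatrixAlgebras.
Context {R : realType} {B : unitalCStarAlgType R}.

Definition mxstar m n (x : 'M[B]_(m, n)) : 'M[B]_(n, m) := (map_mx star x)^T.

(* Norm of the right Hilbert B-module B^n: the 1 x 1 matrix [mxstar xi *m xi]
   is the B-valued inner product of [xi] with itself. *)
Definition col_norm n (xi : 'cV[B]_n) : R :=
  Num.sqrt (cnorm ((mxstar xi *m xi) 0 0)).

(* The C*-norm of M_n(B), as the operator norm of the left action of M_n(B)
   on the Hilbert module B^n.  The supremum is over a bounded nonempty set. *)
Definition mxnorm n (x : 'M[B]_n) : R :=
  sup [set col_norm (x *m xi) | xi in [set xi : 'cV[B]_n | col_norm xi <= 1]].

Definition mxpositive n (a : 'M[B]_n) : Prop :=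
  exists x : 'M[B]_n, a = mxstar x *m x.

(* An element of M_oo(B), presented by a matrix of some size.  The matrices [a]
   and [diag(a, 0)] present the same element: every operation below first pads
   its arguments with zeros to a common size. *)
Record minf := MInf { msize : nat; mval : 'M[B]_msize }.

Definition minf_entry (x : minf) (i j : nat) : B :=
  if (insub i : option 'I_(msize x), insub j : option 'I_(msize x))
    is (Some i', Some j') then mval x i' j' else 0.

Definition minf_pad N (x : minf) : 'M[B]_N :=
  \matrix_(i < N, j < N) minf_entry x i j.

Definition minf_mul (x y : minf) : minf :=
  let N := maxn (msize x) (msize y) in
  @MInf N (minf_pad N x *m minf_pad N y).

Definition minf_sub (x y : minf) : minf :=
  let N := maxn (msize x) (msize y) in
  @MInf N (minf_pad N x - minf_pad N y).

Definition minf_star (x : minf) : minf := MInf (mxstar (mval x)).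

Definition minf_norm (x : minf) : R := mxnorm (mval x).

Record minf_pos := MInfPos {
  pos_val :> minf;
  posP : mxpositive (mval pos_val)
}.

Definition cuntz_le (a b : minf_pos) : Prop :=
  exists v : nat -> minf,
    minf_norm (minf_sub (minf_mul (minf_mul (v k) b) (minf_star (v k))) a)
      @[k --> \oo] --> (0 : R).

Definition cuntz_eq (a b : minf_pos) : Prop := cuntz_le a b /\ cuntz_le b a.

Definition minf_sum (a b : minf) : minf :=
  MInf (block_mx (mval a) 0 0 (mval b)).

Fact minf_sum_positive (a b : minf_pos) : mxpositive (mval (minf_sum a b)).
Proof.
case: a b => [[m a] /= [x ->]] [[n b] /= [y ->]].
exists (block_mx x 0 0 y).
rewrite /mxstar map_block_mx tr_block_mx mulmx_block.
have mx0 p q : map_mx star (0 : 'M[B]_(p, q)) = 0.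
  by apply/matrixP => i j; rewrite !mxE star0.
rewrite !mx0 !trmx0.
by rewrite !mulmx0 !mul0mx !addr0 add0r.
Qed.

Definition pos_sum (a b : minf_pos) : minf_pos :=
  MInfPos (minf_sum_positive a b).

Definition cuntz_class (a : minf_pos) : set minf_pos :=
  [set b | cuntz_eq a b].

(* An element of W(B) is an equivalence class of [cuntz_eq], as a set.  The
   operations are stated on arbitrary representatives and the result of [Wadd]
   (and of [Wmap] below) is saturated for [cuntz_eq], so that, e.g.,
   <a> + <b> = <a (+) b>. *)
Definition Wadd (x y : set minf_pos) : set minf_pos :=
  [set c | exists a b, [/\ x a, y b & cuntz_eq (pos_sum a b) c]].

Definition Wle (x y : set minf_pos) : Prop :=
  exists a b, [/\ x a, y b & cuntz_le a b].

End MatrixAlgebras.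

Arguments minf {R} B.
Arguments minf_pos {R} B.

Definition W {R : realType} (B : unitalCStarAlgType R) : set (set (minf_pos B)) :=
  range (@cuntz_class R B).

Arguments W {R} B.

Section FunctorW.
Context {R : realType} {A B : unitalCStarAlgType R} (phi : starHom A B).

Definition minf_map (a : minf A) : minf B := MInf (map_mx phi (mval a)).

Fact minf_map_positive (a : minf_pos A) : mxpositive (mval (minf_map a)).
Proof.
case: a => [[n a] /= [x ->]]; exists (map_mx phi x).
apply/matrixP => i j; rewrite !mxE raddf_sum; apply: eq_bigr => k _.
by rewrite !mxE /= starhomM starhomS.
Qed.

Definition pos_map (a : minf_pos A) : minf_pos B :=
  MInfPos (minf_map_positive a).

Definition Wmap (x : set (minf_pos A)) : set (minf_pos B) :=
  [set c | exists a, x a /\ cuntz_eq (pos_map a) c].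

End FunctorW.

Definition Wfixed {R : realType} {gT : finGroupType}
    {A : unitalCStarAlgType R} (alpha : cstarAction gT A) :
    set (set (minf_pos A)) :=
  [set x | W A x /\ forall g, Wmap (alpha g) x = x].

(* Main.v *)
(* The projections of a Rokhlin tower give an averaging map
   a |-> sum_g alpha_g (e_1 a e_1) from A into the fixed point algebra which is
   asymptotically multiplicative on any given finite set and asymptotically the
   identity on fixed elements.  Averaging v turns v b v^* ~ a, for a and b
   fixed, into the same relation inside the fixed point algebra, so W(iota) is
   an order embedding.

   For surjectivity let a be positive with alpha_g(a) below a for all g, and let
   X be the closed set of the elements below a.  Averaging repeatedly, every
   fixed element close to X can be corrected to a nearby fixed element of X.
   Given d = lim z a z^* fixed in X, correct the average of a to a fixed b in X
   and approximate the average of z by an invertible fixed w (stable rank one):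
   then d' = w b w^* is fixed, lies in X, is close to d, and a is approximately
   v d' v^* for a suitable v.  As d' lies in X exactly, this can be iterated
   with steps that are small compared to the previous v, and the limit is a fixed
   element equivalent to a.

   This takes place in M_n(A), normed as operators on the Hilbert module A^n.
   The C*-theory it needs is that elements x^* x form a closed cone of squares of
   self-adjoint elements. *)
From HB Require Import structures.
From mathcomp Require Import all_boot all_order all_algebra all_fingroup.
From mathcomp Require Import complex.
From mathcomp Require Import boolp classical_sets functions cardinality reals.
From mathcomp Require Import topology normedtype sequences.
From mathcomp Require Import ring lra.
Require Import Defs.

Set Implicit Arguments.
Unset Strict Implicit.
Unset Printing Implicit Defensive.

Import Order.TTheory GRing.Theory Num.Theory.
Import numFieldNormedType.Exports.

Local Open Scope classical_set_scope.
Local Open Scope ring_scope.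
Local Open Scope complex_scope.

(** Cuntz comparison is closed on the small side only: a limit of elements below [a] is below [a]
    ([cle_closed]), but an element close to one below [a] need not be below it. Likewise, that [a]
    is nearly v d v^* need not survive a perturbation of d, since the size of v is not controlled in
    advance. So each tolerance is chosen only after the previous v is known.

    The cancellation is exact, so no estimate of the norm of w^-1 enters.

    A second constraint is that a positive element over the fixed point algebra must be exhibited as
    k^* k with k fixed. Square roots are therefore limits of an iteration that commutes with every
    *-homomorphism fixing 1 and the given element. Positivity is tested by the norm criterion |c -
    h| <= c, without spectral theory.

    In the constants, the factor |G| comes from the triangle inequality over a tower and the factor
    2 from the crude bound [starhom_bounded]. *)

(** * Null and bounded sequences in a C*-algebra *)

Section NullSequences.
Context {R : realType} {A : unitalCStarAlgType R}.
Implicit Types (x y : A) (u v w b : nat -> A).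

(** Asymptotic identities are treated as congruences modulo null sequences: [null_trans],
    [nullM_sub] and [null_conj] calculate with them, and an epsilon is chosen only at the end. *)
Definition null u := forall e : R, 0 < e -> \forall n \near \oo, cnorm (u n) <= e.

Definition bounded u := exists C : R, forall n, cnorm (u n) <= C.

Lemma null_ext u v : u =1 v -> null u -> null v.
Proof. by move=> /funext ->. Qed.

Lemma null0 : null (fun=> 0).
Proof. by move=> e e0; near=> n; rewrite cnorm0 ltW. Unshelve. all: end_near. Qed.

Lemma nullD u v : null u -> null v -> null (fun n => u n + v n).
Proof.
move=> u0 v0 e e0; have e20 : 0 < e / 2 by lra.
apply: filterS2 (u0 _ e20) (v0 _ e20) => n un vn.
by have := cnormD (u n) (v n); lra.
Qed.

Lemma nullN u : null u -> null (fun n => - u n).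
Proof. by move=> u0 e /u0; apply: filterS => n; rewrite cnormN. Qed.

Lemma nullB u v : null u -> null v -> null (fun n => u n - v n).
Proof. by move=> u0 /nullN; apply: nullD. Qed.

Lemma null_star u : null u -> null (fun n => star (u n)).
Proof. by move=> u0 e /u0; apply: filterS => n; rewrite cnorm_star. Qed.

Lemma null_sum (I : Type) (r : seq I) (u : I -> nat -> A) :
  (forall i, null (u i)) -> null (fun n => \sum_(i <- r) u i n).
Proof.
move=> u0; elim: r => [|i r IH].
  by apply: null_ext null0 => n; rewrite big_nil.
by apply: null_ext (nullD (u0 i) IH) => n; rewrite big_cons.
Qed.

Lemma bounded_pos u : bounded u -> exists2 C : R, 0 < C & forall n, cnorm (u n) <= C.
Proof.
move=> [C uC]; exists (`|C| + 1); first by rewrite ltr_wpDl.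
by move=> n; rewrite (le_trans (uC n))// ler_wpDr// ler_norm.
Qed.

Lemma null_mulr u v : null u -> bounded v -> null (fun n => u n * v n).
Proof.
move=> u0 /bounded_pos[C C0 vC] e e0; have eC0 : 0 < e / C by rewrite divr_gt0.
apply: filterS (u0 _ eC0) => n; rewrite ler_pdivlMr// => un.
apply: le_trans (cnormM _ _) (le_trans _ un).
by rewrite ler_wpM2l// cnorm_ge0.
Qed.

Lemma null_mull u v : bounded u -> null v -> null (fun n => u n * v n).
Proof.
move=> [C uC] v0.
have bu : bounded (fun n => star (u n)) by exists C => n; rewrite cnorm_star.
by apply: null_ext (null_star (null_mulr (null_star v0) bu)) => n; rewrite starM !starK.
Qed.

Lemma bounded_cst x : bounded (fun=> x).
Proof. by exists (cnorm x). Qed.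

Lemma bounded_star u : bounded u -> bounded (fun n => star (u n)).
Proof. by move=> [C uC]; exists C => n; rewrite cnorm_star. Qed.

Lemma boundedM u v : bounded u -> bounded v -> bounded (fun n => u n * v n).
Proof.
move=> [C uC] [D vD]; exists (C * D) => n; apply: le_trans (cnormM _ _) _.
by rewrite ler_pM ?cnorm_ge0.
Qed.

(** The way identities pass to a limit: the difference of the two sides is rewritten as a null
    sequence that does not depend on the index. *)
Lemma null_cst x : null (fun=> x) -> x = 0.
Proof.
move=> x0; apply: (@cnorm_eps0 _ _ _ 1) => e e0 _; rewrite mul1r.
by have /filter_ex[] := x0 e e0.
Qed.

Lemma null_scale (c : R[i]) u : null u -> null (fun n => c *: u n).
Proof.
move=> /(null_mull (bounded_cst (c *: (1 : A)))); apply: null_ext => n.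
by rewrite -scale_mulAl mul1r.
Qed.

Lemma null_trans u v w : null (fun n => u n - v n) -> null (fun n => v n - w n) ->
  null (fun n => u n - w n).
Proof. by move=> uv /(nullD uv); apply: null_ext => n; rewrite addrA subrK. Qed.

Lemma null_sym u v : null (fun n => u n - v n) -> null (fun n => v n - u n).
Proof. by move=> /nullN; apply: null_ext => n; rewrite opprB. Qed.

Lemma nullM_sub u u' v v' : bounded u' -> bounded v ->
  null (fun n => u n - u' n) -> null (fun n => v n - v' n) ->
  null (fun n => u n * v n - u' n * v' n).
Proof.
move=> bu bv uu vv; apply: null_ext (nullD (null_mulr uu bv) (null_mull bu vv)).
by move=> n; rewrite mulrBl mulrBr addrA subrK.
Qed.

Lemma null_self u : null (fun n => u n - u n).
Proof. by apply: null_ext null0 => n; rewrite subrr. Qed.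

Lemma null_sub2 u v u' v' :
  null (fun n => u n - u' n) -> null (fun n => v n - v' n) ->
  null (fun n => (u n - v n) - (u' n - v' n)).
Proof.
move=> uu vv; apply: null_ext (nullB uu vv) => n.
by rewrite !opprB addrACA [RHS]addrACA [- u' n + _]addrC.
Qed.

Lemma null_conj w w' b b' :
  bounded w -> bounded w' -> bounded b -> bounded b' ->
  null (fun n => w n - w' n) -> null (fun n => b n - b' n) ->
  null (fun n => w n * b n * star (w n) - w' n * b' n * star (w' n)).
Proof.
move=> bw bw' bb bb' ww wb; apply: nullM_sub.
- exact: boundedM.
- exact: bounded_star.
- exact: nullM_sub.
- by apply: null_ext (null_star ww) => n; rewrite starB.
Qed.

Lemma null_norm_le u x (M : R) : null (fun n => u n - x) ->
  (\forall n \near \oo, cnorm (u n) <= M) -> cnorm x <= M.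
Proof.
move=> ux uM; apply/ler_addgt0Pr => e e0.
have [n [un uxn]] := filter_ex (filterI uM (ux e e0)).
by have := cnormB (u n) (u n - x); rewrite opprB addrCA subrr addr0; lra.
Qed.

Lemma cauchy_null u :
  (forall e : R, 0 < e -> exists N, forall n m, (N <= n)%N -> (n <= m)%N ->
    cnorm (u m - u n) <= e) -> exists x, null (fun n => u n - x).
Proof.
move=> uC.
have : cvg (u @ \oo).
  apply: cauchy_cvg; apply/cauchyP => e e0.
  have e0' : 0 < complex.Re e by move: e0; rewrite ltcE => /andP[_].
  have eE : e = (complex.Re e)%:C by rewrite RRe_real// gtr0_real.
  have [|N HN] := uC (complex.Re e / 2); first by lra.
  exists (u N); exists N => // m /= Nm.
  rewrite -ball_normE /ball_ /= cnormE eE ltcR cdistC.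
  by have := HN _ _ (leqnn N) Nm; lra.
move=> /cvg_ex[y /cvgrPdist_lt uy]; exists y => e e0.
have [|N _ HN] := uy e%:C; first by rewrite ltcR.
by exists N => // n /HN; rewrite cnormE ltcR cdistC => /ltW.
Qed.

End NullSequences.

Lemma null_hom (R : realType) (A B : unitalCStarAlgType R) (phi : starHom A B)
  (u : nat -> A) : null u -> null (fun n => phi (u n)).
Proof.
move=> u0 e e0; have e20 : 0 < e / 2 by lra.
apply: filterS (u0 _ e20) => n un.
by have := starhom_bounded phi (u n); lra.
Qed.

Section RealScalars.
Context {R : realType} {A : unitalCStarAlgType R}.
Implicit Types (x y : A) (c : R).

Lemma starZr c x : star (c%:C *: x) = c%:C *: star x.
Proof. by rewrite starZ conjc_real. Qed.

Lemma conjci : (('i : R[i])^*)%C = - 'i%C.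
Proof. by apply/eqP; rewrite eq_complex/= oppr0 !eqxx. Qed.

Lemma starZi x : star ('i%C *: x) = - ('i%C *: star x).
Proof. by rewrite starZ conjci scaleNr. Qed.

Lemma scaleii x : 'i%C *: ('i%C *: x) = - x.
Proof. by rewrite scalerA -expr2 sqr_i scaleN1r. Qed.

Lemma cnorm1_le : cnorm (1 : A) <= 1.
Proof.
have := cnorm_id (1 : A); rewrite star1 mulr1.
by have := cnorm_ge0 (1 : A); nra.
Qed.

Lemma cnorm_sa x : star x = x -> cnorm (x * x) = cnorm x ^+ 2.
Proof. by move=> xs; rewrite -cnorm_id xs. Qed.

Lemma cnormZ1 c : 0 <= c -> cnorm (c%:C *: (1 : A)) <= c.
Proof. by move=> c0; rewrite cnormZ// ler_piMr// cnorm1_le. Qed.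

Lemma scaleZZ c d x : c%:C *: (d%:C *: x) = (c * d)%:C *: x.
Proof. by rewrite scalerA rmorphM. Qed.

Lemma scale1C x : 1%:C *: x = x.
Proof. by rewrite -[X in X *: _]/(1 : R[i]) scale1r. Qed.

Lemma square_scale c x : (c%:C *: x) * (c%:C *: x) = (c ^+ 2)%:C *: (x * x).
Proof. by rewrite -scale_mulAl -scale_mulAr scaleZZ. Qed.

End RealScalars.

(** * Square roots and positivity in a C*-algebra *)

(* Majorant of the iteration that defines the square root of [1 - h] when
   [cnorm h <= 1]. *)
Fixpoint sqrt_majorant (R : realType) (n : nat) : R :=
  if n is n'.+1 then (1 + sqrt_majorant R n' ^+ 2) / 2 else 0.

Section SquareRoot.
Context {R : realType} {A : unitalCStarAlgType R}.
Implicit Types (x y h k : A).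

Local Notation r := (sqrt_majorant R).

Lemma sqrt_majorant_itv n : 0 <= r n <= 1.
Proof. by elim: n => [|n /andP[r0 r1]]/=; [lra|apply/andP; split; nra]. Qed.

Lemma sqrt_majorantS n : r n <= r n.+1.
Proof.
by rewrite /=; have := sqr_ge0 (1 - r n); rewrite sqrrB expr1n mul1r mulr2n; lra.
Qed.

(** A fixed point y satisfies 2 y = h + y^2, that is, (1 - y)^2 = 1 - h. The iterates are
    polynomials in h, so they inherit self-adjointness, commutation and invariance from h. *)
Fixpoint sqrt_iter h (n : nat) : A :=
  if n is n'.+1 then 2^-1%:C *: (h + sqrt_iter h n' * sqrt_iter h n') else 0.

Lemma sqrt_iter_norm h n : cnorm h <= 1 -> cnorm (sqrt_iter h n) <= r n.
Proof.
move=> h1; elim: n => [|n IH]/=; first by rewrite cnorm0.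
rewrite cnormZ; last by lra.
have := cnormD h (sqrt_iter h n * sqrt_iter h n).
have := cnormM (sqrt_iter h n) (sqrt_iter h n).
have := cnorm_ge0 (sqrt_iter h n); nra.
Qed.

(** For h of norm 1 the iteration need not contract, so no geometric rate is available. Its
    increments are dominated by those of the scalar iteration for h = 1, where r_{n+2} - r_{n+1} =
    (r_{n+1} + r_n) (r_{n+1} - r_n) / 2; these telescope, and [r] is monotone and bounded. *)
Lemma sqrt_iterS_norm h n : cnorm h <= 1 ->
  cnorm (sqrt_iter h n.+1 - sqrt_iter h n) <= r n.+1 - r n.
Proof.
move=> h1; elim: n => [|n IH].
  have := sqrt_iter_norm 1 h1.
  by rewrite /= !subr0.
set y := sqrt_iter h.
have -> : y n.+2 - y n.+1 =
    2^-1%:C *: (y n.+1 * (y n.+1 - y n) + (y n.+1 - y n) * y n).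
  rewrite {1 2}/y [sqrt_iter h n.+2]/= [in X in _ - X]/= -scalerBr.
  congr (_ *: _); rewrite -!/(y _) opprD addrACA subrr add0r.
  by rewrite mulrBr mulrBl addrA subrK.
rewrite cnormZ; last by lra.
have := cnormD (y n.+1 * (y n.+1 - y n)) ((y n.+1 - y n) * y n).
have := cnormM (y n.+1) (y n.+1 - y n); have := cnormM (y n.+1 - y n) (y n).
have := sqrt_iter_norm n h1; have := sqrt_iter_norm n.+1 h1; rewrite -!/(y _).
move: IH; rewrite -/y => IH yn1 yn mm mm' dd.
have : cnorm (y n.+1) * cnorm (y n.+1 - y n) <= r n.+1 * (r n.+1 - r n).
  by rewrite ler_pM ?cnorm_ge0.
have : cnorm (y n.+1 - y n) * cnorm (y n) <= (r n.+1 - r n) * r n.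
  by rewrite ler_pM ?cnorm_ge0.
have rE2 : r n.+2 = (1 + r n.+1 ^+ 2) / 2 by [].
have rE1 : r n.+1 = (1 + r n ^+ 2) / 2 by [].
rewrite rE2; move: (r n.+1) (r n) rE1 => b a rE1; rewrite !expr2 in rE1 *.
by lra.
Qed.

Lemma sqrt_iter_dist h n m : cnorm h <= 1 -> (n <= m)%N ->
  cnorm (sqrt_iter h m - sqrt_iter h n) <= r m - r n.
Proof.
move=> h1 /subnKC <-; elim: (m - n)%N => [|k IH].
  by rewrite addn0 !subrr cnorm0.
rewrite addnS; have := sqrt_iterS_norm (n + k) h1.
set y := sqrt_iter h in IH *; move: IH.
have := cnormD (y (n + k).+1 - y (n + k)%N) (y (n + k)%N - y n).
by rewrite addrA subrK; lra.
Qed.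

Lemma sqrt_iter_cvg h : cnorm h <= 1 ->
  exists y, null (fun n => sqrt_iter h n - y).
Proof.
move=> h1; apply: cauchy_null => e e0.
have rnd : nondecreasing_seq r by apply/nondecreasing_seqP => n; exact: sqrt_majorantS.
have /cvg_ex[l rl] : cvgn r.
  apply: nondecreasing_is_cvgn => //.
  by exists 1 => _ [n _ <-]; case/andP: (sqrt_majorant_itv n).
have e20 : 0 < e / 2 by lra.
have /cvgrPdist_lt/(_ _ e20)[N _ HN] := rl.
exists N => n m Nn nm; have Nm := leq_trans Nn nm.
apply: le_trans (sqrt_iter_dist h1 nm) _.
have := ler_norm (l - r n); have := HN _ Nn.
have := ler_norm (- (l - r m)); rewrite normrN; have := HN _ Nm.
by rewrite /=; lra.
Qed.

Lemma sqrt_iter_star h n : star h = h -> star (sqrt_iter h n) = sqrt_iter h n.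
Proof.
by move=> hs; elim: n => [|n IH] /=; rewrite ?star0// starZr starD starM hs IH.
Qed.

Lemma sqrt_iter_comm h x n : x * h = h * x -> x * sqrt_iter h n = sqrt_iter h n * x.
Proof.
move=> xh; elim: n => [|n IH] /=; first by rewrite mulr0 mul0r.
rewrite -scale_mulAl -scale_mulAr mulrDl mulrDr xh.
by rewrite mulrA IH -!mulrA IH.
Qed.

Lemma sqrt_iter_hom h (phi : starHom A A) n : phi h = h ->
  phi (sqrt_iter h n) = sqrt_iter h n.
Proof.
by move=> hh; elim: n => [|n IH] /=; rewrite ?raddf0// linearZ raddfD/= starhomM hh IH.
Qed.

(** The bound on [1 - k] records that [k] is itself positive, in the form that [norm_pos] accepts.
    The commutation clause replaces functional calculus, and the clause on [phi] later produces
    square roots fixed by the action. *)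
Lemma cstar_sqrt1B h : star h = h -> cnorm h <= 1 -> exists k,
  [/\ star k = k, k * k = 1 - h, cnorm (1 - k) <= 1,
      forall x, x * h = h * x -> x * k = k * x
    & forall phi : starHom A A, phi 1 = 1 -> phi h = h -> phi k = k].
Proof.
move=> hs h1; have [y yy] := sqrt_iter_cvg h1.
have itb : bounded (sqrt_iter h).
  exists 1 => n; apply: le_trans (sqrt_iter_norm n h1) _.
  by case/andP: (sqrt_majorant_itv n).
have bc := @bounded_cst _ A.
have ys : star y = y.
  apply/eqP; rewrite -subr_eq0; apply/eqP/null_cst.
  apply: null_ext (nullB yy (null_star yy)) => n.
  by rewrite starB sqrt_iter_star// opprB addrCA addrAC subrr add0r.
have yfix : y = 2^-1%:C *: (h + y * y).
  apply/eqP; rewrite -subr_eq0; apply/eqP/null_cst.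
  have y1 : null (fun n => sqrt_iter h n.+1 - y).
    by move=> e /yy[N _ HN]; exists N => // n /= Nn; exact: (HN n.+1 (leqW Nn)).
  have z := null_scale 2^-1%:C (nullM_sub (bc y) itb yy yy).
  apply: null_ext (nullB z y1) => n /=.
  set u := sqrt_iter h n; have -> : u * u - y * y = (h + u * u) - (h + y * y).
    by rewrite opprD addrACA subrr add0r.
  by rewrite scalerBr opprB addrCA [X in _ + X]addrAC subrr add0r.
exists (1 - y); split.
- by rewrite starB star1 ys.
- rewrite mulrBr mulr1 mulrBl mul1r.
  have -> : h = y + y - y * y.
    by rewrite {1 2}yfix half_half addrK.
  by rewrite !opprD opprK !addrA.
- rewrite subKr; apply: null_norm_le yy _; near=> n.
  apply: le_trans (sqrt_iter_norm n h1) _.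
  by case/andP: (sqrt_majorant_itv n).
- move=> x xh; rewrite mulrBl mulrBr mulr1 mul1r; congr (_ - _).
  apply/eqP; rewrite -subr_eq0; apply/eqP/null_cst.
  apply: null_ext (nullB (null_mulr yy (bc x)) (null_mull (bc x) yy)) => n.
  rewrite mulrBl mulrBr (sqrt_iter_comm n xh) opprB.
  by rewrite addrC addrA subrK.
- move=> phi phi1 ph; rewrite raddfB/= phi1; congr (_ - _).
  apply/eqP; rewrite -subr_eq0; apply/eqP/null_cst.
  apply: null_ext (nullB yy (null_hom phi yy)) => n.
  rewrite raddfB/= sqrt_iter_hom// opprB.
  by rewrite addrC addrA subrK.
Unshelve. all: by end_near.
Qed.

End SquareRoot.

Section Positivity.
Context {R : realType} {A : unitalCStarAlgType R}.
Implicit Types (x y z f g h k m p q : A) (c : R).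

(* [f + i g] is a normal element with real part [f]. *)
Lemma cnorm_sqD f g : star f = f -> star g = g -> f * g = g * f ->
  cnorm f ^+ 2 <= cnorm (f * f + g * g).
Proof.
move=> fs gs fg; pose u := f + 'i%C *: g.
have su : star u = f - 'i%C *: g by rewrite starD starZi fs gs.
have uu : star u * u = f * f + g * g.
  rewrite su /u mulrDr !mulrBl -!scale_mulAl -!scale_mulAr fg scaleii opprK.
  by rewrite addrA subrK.
have fE : 2^-1%:C *: (u + star u) = f.
  by rewrite su /u addrACA subrr addr0 scalerDr half_half.
have fu : cnorm f <= cnorm u.
  rewrite -[in leLHS]fE cnormZ; last lra.
  by have := cnormD u (star u); rewrite cnorm_star; lra.
by rewrite -uu cnorm_id lerXn2r ?nnegrE ?cnorm_ge0.
Qed.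

Lemma cnorm_idr x : cnorm (x * star x) = cnorm x ^+ 2.
Proof. by rewrite -{1}[x]starK cnorm_id cnorm_star. Qed.

Definition pos h := exists2 k, star k = k & h = k * k.

Lemma pos_sa h : pos h -> star h = h.
Proof. by move=> [k ks ->]; rewrite starM ks. Qed.

Lemma pos_sq k : star k = k -> pos (k * k).
Proof. by exists k. Qed.

(** With l the square root of 1 - k^2, which commutes with k, the element l + i k satisfies l^2 +
    k^2 = 1, and [cnorm_sqD] bounds l. *)
Lemma cnorm_1Bsq k : star k = k -> cnorm k <= 1 -> cnorm (1 - k * k) <= 1.
Proof.
move=> ks k1.
have k21 : cnorm (k * k) <= 1 by rewrite cnorm_sa//; have := cnorm_ge0 k; nra.
have [|l [ls ll _ lc _]] := cstar_sqrt1B _ k21; first by rewrite starM ks.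
have := @cnorm_sqD l k ls ks; rewrite ll subrK => H.
rewrite -ll cnorm_sa// (le_trans (H _)) ?cnorm1_le//.
by rewrite -lc// mulrA.
Qed.

(** Together with [norm_pos] this is the norm criterion for positivity. It turns sums and limits of
    positive elements into norm estimates. *)
Lemma pos_norm p c : pos p -> cnorm p <= c -> cnorm (c%:C *: (1 : A) - p) <= c.
Proof.
move=> [k ks ->]; rewrite cnorm_sa// => kc.
have c0 : 0 <= c by rewrite (le_trans _ kc)// exprn_ge0// cnorm_ge0.
have [c00|cN0] := eqVneq c 0.
  move: kc; rewrite c00 => kc.
  have /cnorm0_eq0-> : cnorm k = 0 by have := cnorm_ge0 k; nra.
  by rewrite mulr0 subr0 scale0r cnorm0.
pose s := Num.sqrt c; have ss : s ^+ 2 = c by rewrite sqr_sqrtr.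
have s0 : 0 < s by rewrite sqrtr_gt0 lt_neqAle eq_sym cN0.
have -> : c%:C *: (1 : A) - k * k =
    c%:C *: (1 - (s^-1%:C *: k) * (s^-1%:C *: k)).
  by rewrite square_scale scalerBr scaleZZ exprVn ss mulfV// scale1C.
rewrite cnormZ// ler_piMr// cnorm_1Bsq ?starZr ?ks//.
rewrite cnormZ ?invr_ge0 ?(ltW s0)// mulrC ler_pdivrMr// mul1r.
by rewrite -(@ler_pXn2r _ 2) ?nnegrE ?cnorm_ge0 ?(ltW s0)// ss.
Qed.

(** After division by c, h becomes 1 - h' with h' of norm at most 1, which has a square root by
    [cstar_sqrt1B]. *)
Lemma norm_pos h c : star h = h -> cnorm (c%:C *: (1 : A) - h) <= c ->
  exists k, [/\ star k = k, h = k * k,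
    forall x, x * h = h * x -> x * k = k * x
    & forall phi : starHom A A, phi 1 = 1 -> phi h = h -> phi k = k].
Proof.
move=> hs hc; have c0 := le_trans (cnorm_ge0 _) hc.
have [c00|cN0] := eqVneq c 0.
  exists 0; split; rewrite ?star0 ?mulr0//.
  - move: hc; rewrite c00 scale0r sub0r cnormN => hc.
    by apply: cnorm0_eq0; have := cnorm_ge0 h; lra.
  - by move=> x _; rewrite mulr0 mul0r.
  - by move=> phi _ _; rewrite raddf0.
have ci0 : 0 <= c^-1 by rewrite invr_ge0.
pose h' := c^-1%:C *: (c%:C *: (1 : A) - h).
have h's : star h' = h' by rewrite /h' starZr starB starZr star1 hs.
have h'1 : cnorm h' <= 1.
  by rewrite cnormZ// mulrC ler_pdivrMr ?mul1r// lt_neqAle eq_sym cN0.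
have hE : 1 - h' = c^-1%:C *: h.
  by rewrite /h' scalerBr scaleZZ mulVf// scale1C subKr.
have [k [ks kk _ kc kphi]] := cstar_sqrt1B h's h'1.
exists ((Num.sqrt c)%:C *: k); split.
- by rewrite starZr ks.
- by rewrite square_scale kk hE scaleZZ sqr_sqrtr// mulfV// scale1C.
- move=> x xh; rewrite -scale_mulAl -scale_mulAr kc//.
  rewrite /h' -scale_mulAl -scale_mulAr mulrBr mulrBl xh.
  by rewrite -scale_mulAl -scale_mulAr mulr1 mul1r.
- move=> phi phi1 ph; rewrite linearZ/= kphi//.
  by rewrite /h' linearZ/= raddfB/= linearZ/= phi1 ph.
Qed.

Lemma pos_sqrt h : pos h -> exists k, [/\ star k = k, h = k * k,
    forall x, x * h = h * x -> x * k = k * x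
    & forall phi : starHom A A, phi 1 = 1 -> phi h = h -> phi k = k].
Proof. by move=> hp; have := pos_norm hp (lexx _); apply/norm_pos/pos_sa. Qed.

Lemma posD p q : pos p -> pos q -> pos (p + q).
Proof.
move=> pp qp.
have [||k [ks ? _ _]] := @norm_pos (p + q) (cnorm p + cnorm q); last by exists k.
  by rewrite starD !pos_sa.
rewrite rmorphD/= scalerDl opprD addrACA (le_trans (cnormD _ _))//.
by rewrite lerD// pos_norm.
Qed.

Lemma pos0 : pos 0.
Proof. by exists 0; rewrite ?star0 ?mulr0. Qed.

Lemma pos_big_sum (I : Type) (r : seq I) (p : I -> A) :
  (forall i, pos (p i)) -> pos (\sum_(i <- r) p i).
Proof. by move=> pp; elim/big_ind: _ => //; [exact: pos0|exact: posD]. Qed.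

Lemma posZ c p : 0 <= c -> pos p -> pos (c%:C *: p).
Proof.
move=> c0 [k ks ->]; exists ((Num.sqrt c)%:C *: k); first by rewrite starZr ks.
by rewrite square_scale sqr_sqrtr.
Qed.

Lemma pos_lim (p : nat -> A) q : (forall n, pos (p n)) ->
  null (fun n => p n - q) -> pos q.
Proof.
move=> pp pq.
have [||k [ks ? _ _]] := @norm_pos q (cnorm q + 1); last by exists k.
- apply/eqP; rewrite -subr_eq0; apply/eqP/null_cst.
  apply: null_ext (nullB pq (null_star pq)) => n.
  by rewrite starB pos_sa// opprB addrC addrA subrK.
- pose u n := (cnorm q + 1)%:C *: (1 : A) - p n.
  apply: (@null_norm_le _ _ u).
    apply: null_ext (nullN pq) => n.
    by rewrite /u !opprB [RHS]addrC addrA subrK.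
  apply: filterS (pq 1 ltr01) => n pn; apply: pos_norm => //.
  by have := cnormD q (p n - q); rewrite addrC subrK; lra.
Qed.

Lemma sq0 m : star m = m -> m * m = 0 -> m = 0.
Proof.
move=> ms mm; apply: cnorm0_eq0; have := cnorm_sa ms; rewrite mm cnorm0.
by move/esym/eqP; rewrite sqrf_eq0 => /eqP.
Qed.

Lemma pos_id_add z : pos (star z * z + z * star z).
Proof.
pose a := z + star z; pose b := 'i%C *: (z - star z).
have aS : star a = a by rewrite /a starD starK addrC.
have bS : star b = b by rewrite /b starZi starB starK -scalerN opprB.
suff -> : star z * z + z * star z = 2^-1%:C *: (a * a + b * b).
  by apply: posZ; [lra|apply: posD; exact: pos_sq].
rewrite /b -scale_mulAl -scale_mulAr scaleii /a.
have sqP (u v : A) : (u + v) * (u + v) = (u * u + v * v) + (v * u + u * v).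
  by rewrite mulrDl !mulrDr addrACA [u * v + v * v]addrC addrACA.
rewrite !sqP !mulrN !mulNr opprK.
set P := _ + star z * star z; set Q := _ + z * star z.
have -> : - (star z * z) - z * star z = - Q by rewrite opprD.
by rewrite opprB [Q - P]addrC addrA [P + Q]addrC addrK scalerDr half_half.
Qed.

(* If [z] has norm 1, then [q = z - z (star z) z] equals both [z (1 + m^2)], of
   norm at least 2, and [(1 - z (star z)) z], of norm at most 1. *)
Lemma cstar_neg z m : star m = m -> star z * z = - (m * m) -> z = 0.
Proof.
have key x n : cnorm x = 1 -> star n = n -> star x * x = - (n * n) -> False.
  move=> x1 ns xn.
  have [k ks kk] : pos (x * star x).
    suff -> : x * star x = (star x * x + x * star x) + n * n.
      by apply: posD; [exact: pos_id_add | exact: pos_sq].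
    by rewrite xn [- _ + _]addrC subrK.
  have k1 : cnorm k = 1.
    apply/eqP; rewrite -sqrp_eq1 ?cnorm_ge0// -cnorm_sa// -kk.
    by rewrite cnorm_idr x1 expr1n.
  have n1 : cnorm n = 1.
    apply/eqP; rewrite -sqrp_eq1 ?cnorm_ge0// -cnorm_sa// -cnormN -xn.
    by rewrite cnorm_id x1 expr1n.
  have [q qE] : exists q, q = x - x * star x * x by eexists.
  have qk : cnorm q <= 1.
    have q2 : q * star q = star (k * (1 - k * k)) * (k * (1 - k * k)).
      rewrite [star (k * _)]starM starB star1 starM ks -!mulrA [k * (k * _)]mulrA.
      have -> : q = (1 - k * k) * x by rewrite qE mulrBl mul1r -kk.
      by rewrite starM starB star1 starM ks !mulrA -[_ * x * star x]mulrA kk !mulrA.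
    have : cnorm q ^+ 2 = cnorm (k * (1 - k * k)) ^+ 2.
      by rewrite -cnorm_idr q2 cnorm_id.
    move/eqP; rewrite eqrXn2 ?cnorm_ge0// => /eqP->.
    apply: le_trans (cnormM _ _) _; rewrite k1 mul1r.
    by apply: cnorm_1Bsq; rewrite ?k1.
  have qn : 2 <= cnorm q.
    have [w wE] : exists w, w = n + n * n * n by eexists.
    have ws : star w = w.
      by rewrite wE starD !starM ns mulrA.
    have qw : cnorm q = cnorm w.
      apply/eqP; rewrite -(@eqrXn2 _ 2) ?cnorm_ge0// -!cnorm_id ws.
      have -> : q = x * (1 + n * n).
        by rewrite qE -mulrA xn mulrN opprK mulrDr mulr1.
      have -> : w = (1 + n * n) * n by rewrite wE mulrDl mul1r.
      rewrite starM -mulrA [star x * _]mulrA xn starD star1 starM ns.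
      rewrite mulNr mulrN cnormN.
      by rewrite !(mulrDl, mulrDr, mul1r, mulr1, mulrA).
    (* The identity (n + n^3)^2 = (2 n^2)^2 + (n - n^3)^2 lets [cnorm_sqD] bound the norm of w below
       by that of 2 n^2. *)
    have n4 : cnorm (n * n + n * n) = 2.
      have -> : n * n + n * n = (2 : R)%:C *: (n * n).
        by rewrite -[2]/(1 + 1) rmorphD scalerDl !scale1C.
      by rewrite cnormZ// cnorm_sa// n1 expr1n mulr1.
    have := @cnorm_sqD (n * n + n * n) (n - n * n * n).
    rewrite starD starB !starM ns mulrA => /(_ erefl erefl).
    have -> : (n * n + n * n) * (n * n + n * n) +
       (n - n * n * n) * (n - n * n * n) = w * w.
      rewrite wE !mulrDl !mulrDr !mulNr !mulrN !mulrA opprK.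
      set P := n * n; set Q := P * n * n; set S := Q * n * n; set T := Q + Q.
      rewrite [- Q + S]addrC [_ + (S - Q)]addrACA -opprD -/T addrA addrAC addrK.
      by rewrite [Q + S]addrC [RHS]addrACA addrC.
    rewrite n4 qw cnorm_sa// => H.
    rewrite -(@ler_pXn2r _ 2) ?nnegrE ?cnorm_ge0//; apply: H.
    by rewrite !(mulrDl, mulrDr, mulrN, mulNr, mulrA) addrACA.
  by lra.
move=> ms zm; have [z0|z0] := eqVneq (cnorm z) 0; first exact: cnorm0_eq0.
exfalso; pose c := (cnorm z)^-1; have c0 : 0 <= c by rewrite invr_ge0 cnorm_ge0.
apply: (key (c%:C *: z) (c%:C *: m)); first by rewrite cnormZ// mulVf.
  by rewrite starZr ms.
by rewrite starZr square_scale -scale_mulAl -scale_mulAr scaleZZ zm scalerN.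
Qed.

(* With [t = (star y) y] and [a = |t|], the element [y (a - t)] has a nonpositive
   square, hence vanishes. *)
Lemma pos_id y : pos (star y * y).
Proof.
have key x : cnorm x <= 1 -> pos (star x * x).
  move=> x1; pose t := star x * x; have ts : star t = t by rewrite starM starK.
  have t1 : cnorm t <= 1 by rewrite cnorm_id exprn_ile1// cnorm_ge0.
  have [||a [as_ aa a1 ac _]] := @cstar_sqrt1B _ _ (1 - t * t).
  - by rewrite starB star1 starM ts.
  - exact: cnorm_1Bsq.
  have ta : t * a = a * t by apply: ac; rewrite mulrBl mulrBr mulr1 mul1r mulrA.
  (* The bound on 1 - a makes the chosen square root [a] of t^2 positive, so that it deserves to be
     called |t|; [k] is its square root. *)
  have [|k [ks ak kc _]] := norm_pos as_ (c := 1); first by rewrite scale1C.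
  pose m := a - t; have ms : star m = m by rewrite starB as_ ts.
  have ma : m * a = a * m by rewrite mulrBl mulrBr ta.
  have mk : m * k = k * m by exact: kc.
  have mt : m * t = - (a * m).
    by rewrite mulrBl mulrBr opprB aa subKr -ta.
  have mk0 : m * k = 0.
    have mks : star (m * k) = m * k by rewrite starM ms ks.
    have zz : star (x * m) * (x * m) = - ((m * k) * (m * k)).
      rewrite starM ms -mulrA [star x * _]mulrA [m * (_ * _)]mulrA mt mulNr.
      by rewrite {2}mk mulrA -[m * k * k]mulrA -ak ma.
    have := cstar_neg mks zz; move: zz => /[swap] ->.
    by rewrite mulr0 => /eqP; rewrite eq_sym oppr_eq0 => /eqP; exact: sq0.
  have m0 : m = 0.
    apply: sq0 => //; rewrite {2}/m mulrBr mt -ma ak mulrA mk0 mul0r.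
    by rewrite oppr0 subr0.
  exists k => //; rewrite -ak; apply/esym/eqP; rewrite -subr_eq0.
  by apply/eqP.
have [y0|y0] := eqVneq (cnorm y) 0.
  by rewrite (cnorm0_eq0 y0) mulr0; exact: pos0.
have c0 : 0 <= (cnorm y)^-1 by rewrite invr_ge0 cnorm_ge0.
have -> : star y * y = (cnorm y ^+ 2)%:C *:
    (star ((cnorm y)^-1%:C *: y) * ((cnorm y)^-1%:C *: y)).
  rewrite starZr -scale_mulAl -scale_mulAr !scaleZZ -mulrA -expr2 exprVn mulfV ?scale1C//.
  by rewrite sqrf_eq0.
apply: posZ; first by rewrite exprn_ge0// cnorm_ge0.
by apply: key; rewrite cnormZ// mulVf.
Qed.

Lemma pos_conj p x : pos p -> pos (star x * p * x).
Proof.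
move=> [k ks ->].
suff -> : star x * (k * k) * x = star (k * x) * (k * x) by exact: pos_id.
by rewrite starM ks !mulrA.
Qed.

Lemma pos_scale1B p c : pos p -> cnorm p <= c -> pos (c%:C *: (1 : A) - p).
Proof.
move=> pp pc; have c0 := le_trans (cnorm_ge0 _) pc.
have [||k [ks -> _ _]] := @norm_pos (c%:C *: (1 : A) - p) c; last by exists k.
- by rewrite starB starZr star1 pos_sa.
- by rewrite subKr.
Qed.

(** The element c - p = (c - p - q) + q is positive. Its root k commutes with the root f of p, and
    f^2 + k^2 = c, so [cnorm_sqD] applies. *)
Lemma cnorm_posD p q : pos p -> pos q -> cnorm p <= cnorm (p + q).
Proof.
move=> pp qp; set c := cnorm (p + q); have c0 : 0 <= c := cnorm_ge0 _.
have := posD (pos_scale1B (posD pp qp) (lexx c)) qp.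
rewrite opprD addrA subrK => rp.
have [k [ks kk kc _]] := pos_sqrt rp; have [f fs fp] := pp.
have fk : f * k = k * f.
  apply: kc; rewrite mulrBr mulrBl fp mulrA -scale_mulAl -scale_mulAr.
  by rewrite mulr1 mul1r.
have := cnorm_sqD fs ks fk; rewrite -kk -fp [p + _]addrC subrK.
rewrite -cnorm_sa// -fp => /le_trans; apply.
exact: cnormZ1.
Qed.

End Positivity.

(** * Matrix algebras as C*-algebras *)

Section EntrywiseNorm.
Context {R : realType} {B : unitalCStarAlgType R}.

(** [mxnorm] exists for square matrices only. This norm also covers rectangular ones and is
    equivalent to [mxnorm] on square ones, by [mxnorm_le_entry] and [cnorm_entry_mxnorm]. *)
Definition entry_norm m n (x : 'M[B]_(m, n)) : R := \sum_i \sum_j cnorm (x i j).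

Lemma entry_norm_ge0 m n (x : 'M[B]_(m, n)) : 0 <= entry_norm x.
Proof. by do 2 (apply: sumr_ge0 => ? _); exact: cnorm_ge0. Qed.

Lemma entry_normD m n (x y : 'M[B]_(m, n)) :
  entry_norm (x + y) <= entry_norm x + entry_norm y.
Proof.
rewrite -big_split ler_sum// => i _; rewrite -big_split ler_sum// => j _ /=.
by rewrite mxE cnormD.
Qed.

Lemma cnorm_sum (I : Type) (r : seq I) (F : I -> B) :
  cnorm (\sum_(i <- r) F i) <= \sum_(i <- r) cnorm (F i).
Proof.
elim/big_ind2 : _ => [|x1 x2 y1 y2 h1 h2|//]; first by rewrite cnorm0.
by apply: le_trans (cnormD _ _) _; exact: lerD.
Qed.

Lemma entry_normM m n p (x : 'M[B]_(m, n)) (y : 'M[B]_(n, p)) :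
  entry_norm (x *m y) <= entry_norm x * entry_norm y.
Proof.
rewrite /entry_norm mulr_suml ler_sum// => i _.
apply: (@le_trans _ _ (\sum_k \sum_j cnorm (x i j) * cnorm (y j k))).
  apply: ler_sum => k _; rewrite mxE; apply: le_trans (cnorm_sum _ _) _.
  by apply: ler_sum => j _; exact: cnormM.
rewrite exchange_big mulr_suml ler_sum//= => j _.
rewrite -mulr_sumr ler_wpM2l ?cnorm_ge0// [leRHS](bigD1 j)//= ler_wpDr//.
by do 2 (apply: sumr_ge0 => ? _); exact: cnorm_ge0.
Qed.

Lemma entry_norm_star m n (x : 'M[B]_(m, n)) : entry_norm (mxstar x) = entry_norm x.
Proof.
rewrite /entry_norm exchange_big; apply: eq_bigr => i _; apply: eq_bigr => j _.
by rewrite !mxE cnorm_star.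
Qed.

Lemma mxstarK m n : cancel (@mxstar R B m n) (@mxstar R B n m).
Proof. by move=> x; apply/matrixP => i j; rewrite !mxE starK. Qed.

Lemma mxstarD m n : {morph @mxstar R B m n : x y / x + y}.
Proof. by move=> x y; apply/matrixP => i j; rewrite !mxE starD. Qed.

Lemma mxstarM m n p (x : 'M[B]_(m, n)) (y : 'M[B]_(n, p)) :
  mxstar (x *m y) = mxstar y *m mxstar x.
Proof.
apply/matrixP => i j; rewrite !mxE (big_morph _ starD star0).
by apply: eq_bigr => k _; rewrite !mxE starM.
Qed.

End EntrywiseNorm.

Section HilbertModule.
Context {R : realType} {B : unitalCStarAlgType R} {n : nat}.
Implicit Types (xi eta : 'cV[B]_n) (x y : 'M[B]_n) (b : B).

Definition inner xi eta : B := (mxstar xi *m eta) 0 0.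

Lemma innerE xi eta : inner xi eta = \sum_i star (xi i 0) * eta i 0.
Proof. by rewrite /inner mxE; apply: eq_bigr => i _; rewrite !mxE. Qed.

Lemma star_inner xi eta : star (inner xi eta) = inner eta xi.
Proof.
rewrite !innerE (big_morph _ starD star0); apply: eq_bigr => i _.
by rewrite starM starK.
Qed.

Lemma inner_pos xi : pos (inner xi xi).
Proof. by rewrite innerE; apply: pos_big_sum => i; exact: pos_id. Qed.

Lemma innerDr xi eta eta' : inner xi (eta + eta') = inner xi eta + inner xi eta'.
Proof. by rewrite /inner mulmxDr mxE. Qed.

Lemma innerDl xi eta eta' : inner (eta + eta') xi = inner eta xi + inner eta' xi.
Proof. by rewrite -star_inner innerDr starD !star_inner. Qed.

Lemma innerNr xi eta : inner xi (- eta) = - inner xi eta.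
Proof. by rewrite /inner mulmxN mxE. Qed.

Lemma innerNl xi eta : inner (- eta) xi = - inner eta xi.
Proof. by rewrite -star_inner innerNr starN !star_inner. Qed.

Lemma inner_mxl x xi eta : inner (x *m xi) eta = inner xi (mxstar x *m eta).
Proof. by rewrite /inner mxstarM mulmxA. Qed.

Definition rscale xi b : 'cV[B]_n := \col_i (xi i 0 * b).

Lemma inner_rscale xi eta b : inner xi (rscale eta b) = inner xi eta * b.
Proof.
by rewrite !innerE mulr_suml; apply: eq_bigr => i _; rewrite mxE mulrA.
Qed.

Lemma inner_rscalel xi eta b : inner (rscale eta b) xi = star b * inner eta xi.
Proof. by rewrite -star_inner inner_rscale starM star_inner. Qed.

Lemma mul_rscale x xi b : x *m rscale xi b = rscale (x *m xi) b.
Proof.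
apply/matrixP => i j; rewrite !mxE mulr_suml.
by apply: eq_bigr => k _; rewrite !mxE mulrA.
Qed.

Lemma col_norm_ge0 xi : 0 <= col_norm xi.
Proof. exact: sqrtr_ge0. Qed.

Lemma col_norm_sq xi : col_norm xi ^+ 2 = cnorm (inner xi xi).
Proof. by rewrite sqr_sqrtr// cnorm_ge0. Qed.

Lemma col_norm_entry xi i : cnorm (xi i 0) <= col_norm xi.
Proof.
rewrite -(@ler_pXn2r _ 2) ?nnegrE ?cnorm_ge0 ?col_norm_ge0//.
rewrite col_norm_sq -cnorm_id innerE (bigD1 i)//=.
apply: cnorm_posD; first exact: pos_id.
rewrite big_mkcond /=; apply: pos_big_sum => j; case: ifP => _.
  exact: pos_id.
exact: pos0.
Qed.

Lemma cauchy_schwarz xi eta : cnorm (inner xi eta) <= col_norm xi * col_norm eta.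
Proof.
set s := cnorm (inner eta eta).
have [s0|s0] := eqVneq s 0.
  have -> : eta = 0.
    apply/colP => i; rewrite mxE; apply/cnorm0_eq0/eqP.
    rewrite eq_le cnorm_ge0 andbT (le_trans (col_norm_entry _ i))//.
    by rewrite /col_norm -[cnorm _]/s s0 sqrtr0.
  have -> : inner xi 0 = 0 by rewrite innerE big1// => i _; rewrite mxE mulr0.
  by rewrite cnorm0 mulr_ge0// col_norm_ge0.
have sp : 0 < s by rewrite lt_neqAle eq_sym s0 cnorm_ge0.
have si0 : 0 <= s^-1 by rewrite invr_ge0 ltW.
(* [rscale eta b] is an approximate projection of xi on eta, with the norm s in place of the
   possibly non-invertible <eta, eta>. The defect s^-2 c^* (s - <eta, eta>) c is positive, and
   adding it to the inner square of the remainder leaves <xi, xi> - s^-1 c^* c. *)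
pose c := inner eta xi; pose b := s^-1%:C *: c.
have p1 := inner_pos (xi - rscale eta b).
have p2 := pos_conj c (pos_scale1B (inner_pos eta) (lexx s)).
have {p1 p2} := posD p1 (posZ (exprn_ge0 2 si0) p2).
set T := (X in pos X); have -> : T = inner xi xi - s^-1%:C *: (star c * c).
  rewrite /T !(innerDl, innerDr, innerNl, innerNr, inner_rscale, inner_rscalel).
  rewrite -[inner xi eta]star_inner -/c.
  rewrite /b starZr -!scale_mulAl -!scale_mulAr -?scale_mulAl scaleZZ -expr2.
  rewrite mulrBr mulrBl -scale_mulAr mulr1 -scale_mulAl scalerBr scaleZZ.
  have -> : s^-1 ^+ 2 * s = s^-1 by rewrite expr2 -mulrA mulVf// mulr1.
  by rewrite -opprD subrK.
move=> p; have := cnorm_posD (posZ si0 (pos_id c)) p.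
rewrite addrC subrK cnormZ// cnorm_id -col_norm_sq.
rewrite mulrC ler_pdivrMr// /s -col_norm_sq -exprMn.
by rewrite ler_pXn2r ?nnegrE ?cnorm_ge0 ?mulr_ge0 ?col_norm_ge0// -cnorm_star star_inner.
Qed.

Lemma col_normD xi eta : col_norm (xi + eta) <= col_norm xi + col_norm eta.
Proof.
rewrite -(@ler_pXn2r _ 2) ?nnegrE ?addr_ge0 ?col_norm_ge0//.
rewrite sqrrD !col_norm_sq innerDl !innerDr.
have := cauchy_schwarz xi eta; have := cauchy_schwarz eta xi.
have := cnormD (inner xi xi + inner xi eta) (inner eta xi + inner eta eta).
have := cnormD (inner xi xi) (inner xi eta).
have := cnormD (inner eta xi) (inner eta eta).
by rewrite mulr2n; lra.
Qed.

Lemma col_norm0 : col_norm (0 : 'cV[B]_n) = 0.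
Proof.
rewrite /col_norm (_ : _ 0 0 = 0) ?cnorm0 ?sqrtr0//.
by rewrite mulmx0 mxE.
Qed.

Lemma col_norm_rscale xi (c : R) : 0 <= c ->
  col_norm (rscale xi (c%:C *: (1 : B))) = c * col_norm xi.
Proof.
move=> c0; apply/eqP.
rewrite -(@eqrXn2 _ 2) ?mulr_ge0 ?col_norm_ge0// exprMn !col_norm_sq.
rewrite inner_rscale inner_rscalel starZr star1 -scale_mulAl -scale_mulAr mul1r mulr1.
by rewrite scaleZZ cnormZ ?mulr_ge0.
Qed.

Lemma col_norm_le xi : col_norm xi <= \sum_i cnorm (xi i 0).
Proof.
have S0 : 0 <= \sum_i cnorm (xi i 0) by apply: sumr_ge0 => i _; exact: cnorm_ge0.
rewrite -(@ler_pXn2r _ 2) ?nnegrE ?col_norm_ge0// col_norm_sq innerE.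
apply: le_trans (cnorm_sum _ _) _; rewrite expr2 mulr_suml ler_sum// => i _.
rewrite cnorm_id expr2 ler_wpM2l ?cnorm_ge0// (bigD1 i)//= ler_wpDr//.
by apply: sumr_ge0 => j _; exact: cnorm_ge0.
Qed.

Lemma col_norm_mul x xi : col_norm (x *m xi) <= entry_norm x * col_norm xi.
Proof.
apply: le_trans (col_norm_le _) _; rewrite mulr_suml ler_sum// => i _.
rewrite mxE (le_trans (cnorm_sum _ _))// mulr_suml ler_sum// => j _.
by rewrite (le_trans (cnormM _ _))// ler_wpM2l ?cnorm_ge0// col_norm_entry.
Qed.

Lemma mxnorm_has_sup x :
  has_sup [set col_norm (x *m xi) | xi in [set xi : 'cV[B]_n | col_norm xi <= 1]].
Proof.
split; first by exists (col_norm (x *m 0)), 0 => //=; rewrite col_norm0.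
exists (entry_norm x) => _ [xi /= xi1 <-].
by rewrite (le_trans (col_norm_mul _ _))// ler_piMr// entry_norm_ge0.
Qed.

Lemma mxnorm_le x c : (forall xi, col_norm xi <= 1 -> col_norm (x *m xi) <= c) ->
  mxnorm x <= c.
Proof.
move=> H; apply: ge_sup; first by case: (mxnorm_has_sup x).
by move=> _ [xi xi1 <-]; exact: H.
Qed.

Lemma mxnorm_ge x xi : col_norm (x *m xi) <= mxnorm x * col_norm xi.
Proof.
have H1 eta : col_norm eta <= 1 -> col_norm (x *m eta) <= mxnorm x.
  by move=> eta1; apply: ub_le_sup; [case: (mxnorm_has_sup x)|exists eta].
have [xi0|xi0] := eqVneq (col_norm xi) 0.
  have -> : xi = 0.
    apply/colP => i; rewrite mxE; apply/cnorm0_eq0/eqP.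
    by rewrite eq_le cnorm_ge0 andbT (le_trans (col_norm_entry _ i))// xi0.
  by rewrite mulmx0 !col_norm0 mulr0.
have xip : 0 < col_norm xi by rewrite lt_neqAle eq_sym xi0 col_norm_ge0.
have ci0 : 0 <= (col_norm xi)^-1 by rewrite invr_ge0 ltW.
have := H1 (rscale xi ((col_norm xi)^-1%:C *: (1 : B))).
rewrite mul_rscale !col_norm_rscale// mulVf// => /(_ (lexx _)).
by rewrite mulrC ler_pdivrMr.
Qed.

Lemma mxnorm_ge0 x : 0 <= mxnorm x.
Proof.
have := mxnorm_ge x 0; rewrite mulmx0 col_norm0 mulr0 => _.
apply: le_trans (col_norm_ge0 (x *m 0)) _.
by apply: ub_le_sup; [case: (mxnorm_has_sup x)|exists 0 => //=; rewrite col_norm0].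
Qed.

Lemma mxnorm_le_entry x : mxnorm x <= entry_norm x.
Proof.
apply: mxnorm_le => xi xi1; apply: le_trans (col_norm_mul _ _) _.
by rewrite ler_piMr// entry_norm_ge0.
Qed.

Lemma cnorm_entry_mxnorm x i j : cnorm (x i j) <= mxnorm x.
Proof.
pose xi : 'cV[B]_n := \col_k (k == j)%:R.
have xiE : inner xi xi = 1.
  rewrite innerE (bigD1 j)//= !mxE eqxx star1 mulr1 big1 ?addr0// => k kj.
  by rewrite !mxE (negbTE kj) mulr0.
have -> : x i j = (x *m xi) i 0.
  rewrite mxE (bigD1 j)//= !mxE eqxx mulr1 big1 ?addr0// => k kj.
  by rewrite !mxE (negbTE kj) mulr0.
apply: le_trans (col_norm_entry _ _) (le_trans (mxnorm_ge _ _) _).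
rewrite ler_piMr ?mxnorm_ge0// -(@ler_pXn2r _ 2) ?nnegrE ?col_norm_ge0//.
by rewrite col_norm_sq xiE expr1n cnorm1_le.
Qed.

Lemma mxnormD x y : mxnorm (x + y) <= mxnorm x + mxnorm y.
Proof.
apply: mxnorm_le => xi xi1; rewrite mulmxDl (le_trans (col_normD _ _))//.
by rewrite lerD// (le_trans (mxnorm_ge _ _))// ler_piMr// mxnorm_ge0.
Qed.

Lemma mxnormM x y : mxnorm (x *m y) <= mxnorm x * mxnorm y.
Proof.
apply: mxnorm_le => xi xi1; rewrite -mulmxA (le_trans (mxnorm_ge _ _))//.
rewrite ler_wpM2l ?mxnorm_ge0// (le_trans (mxnorm_ge _ _))//.
by rewrite ler_piMr// mxnorm_ge0.
Qed.

(** Moving x across the inner product gives |x xi|^2 = |<xi, x^* x xi>|, to which Cauchy-Schwarz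
    applies. *)
Lemma mxnorm_sq_le x : mxnorm x ^+ 2 <= mxnorm (mxstar x *m x).
Proof.
have M0 := mxnorm_ge0 (mxstar x *m x).
rewrite -[leRHS]sqr_sqrtr// ler_pXn2r ?nnegrE ?mxnorm_ge0 ?sqrtr_ge0//.
apply: mxnorm_le => xi xi1.
rewrite -(@ler_pXn2r _ 2) ?nnegrE ?sqrtr_ge0 ?col_norm_ge0// col_norm_sq sqr_sqrtr//.
rewrite inner_mxl mulmxA (le_trans (cauchy_schwarz _ _))//.
apply: (@le_trans _ _ (col_norm (mxstar x *m x *m xi))).
  by rewrite ler_piMl// col_norm_ge0.
by rewrite (le_trans (mxnorm_ge _ _))// ler_piMr// mxnorm_ge0.
Qed.

Lemma mxnorm_star x : mxnorm (mxstar x) = mxnorm x.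
Proof.
suff H y : mxnorm y <= mxnorm (mxstar y).
  by apply/eqP; rewrite eq_le H -{2}[x]mxstarK H.
have := mxnorm_sq_le y; have := mxnormM (mxstar y) y.
have [->|y0] := eqVneq (mxnorm y) 0; first by rewrite mxnorm_ge0.
have yp : 0 < mxnorm y by rewrite lt_neqAle eq_sym y0 mxnorm_ge0.
by move=> h1 h2; have := le_trans h2 h1; rewrite expr2 ler_pM2r.
Qed.

Lemma mxnorm_id x : mxnorm (mxstar x *m x) = mxnorm x ^+ 2.
Proof.
apply/eqP; rewrite eq_le mxnorm_sq_le andbT (le_trans (mxnormM _ _))//.
by rewrite mxnorm_star expr2.
Qed.

End HilbertModule.

Section ComplexModulus.
Context {R : realType}.
Implicit Types c : R[i].

Lemma Re_normrE c : (complex.Re `|c|)%:C = `|c|.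
Proof. by rewrite (RRe_real (ger0_real (normr_ge0 c))). Qed.

Lemma Re_normr_ge0 c : 0 <= complex.Re `|c|.
Proof. by rewrite -lecR Re_normrE; exact: normr_ge0. Qed.

End ComplexModulus.

(* An alias, to keep the entrywise uniform structure of ['M[B]_n] out of the
   way of the one given by [mxnorm]. *)
Definition mxalg (R : realType) (B : unitalCStarAlgType R) (n : nat) : Type := 'M[B]_n.

Section MatrixCStarAlgebra.
Context {R : realType} {B : unitalCStarAlgType R} {n : nat}.
Local Notation M := (mxalg B n).

HB.instance Definition _ := GRing.Zmodule.copy M 'M[B]_n.

(** The scaling of ['M[B]_n] takes its scalars in [B], so complex scalars have to act entrywise. *)
Let mx_scale (c : R[i]) (x : M) : M := map_mx ( *:%R c) (x : 'M[B]_n).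

Fact mx_scalerA a b (x : M) : mx_scale a (mx_scale b x) = mx_scale (a * b) x.
Proof. by apply/matrixP => i j; rewrite !mxE scalerA. Qed.

Fact mx_scale1r : left_id 1 mx_scale.
Proof. by move=> x; apply/matrixP => i j; rewrite !mxE scale1r. Qed.

Fact mx_scalerDr : right_distributive mx_scale +%R.
Proof. by move=> c x y; apply/matrixP => i j; rewrite !mxE scalerDr. Qed.

Fact mx_scalerDl (x : M) : {morph mx_scale^~ x : a b / a + b}.
Proof. by move=> a b; apply/matrixP => i j; rewrite !mxE scalerDl. Qed.

HB.instance Definition _ := GRing.Zmodule_isLmodule.Build R[i] M
  mx_scalerA mx_scale1r mx_scalerDr mx_scalerDl.

Let mx_norm (x : M) : R[i] := (mxnorm (x : 'M[B]_n))%:C.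

Fact mx_normD (x y : M) : mx_norm (x + y) <= mx_norm x + mx_norm y.
Proof. by rewrite -rmorphD lecR mxnormD. Qed.

Lemma scale_mulmxl (c : R[i]) m (x : 'M[B]_n) (y : 'M[B]_(n, m)) :
  map_mx ( *:%R c) (x *m y) = map_mx ( *:%R c) x *m y.
Proof.
apply/matrixP => i j; rewrite !mxE scaler_sumr.
by apply: eq_bigr => k _; rewrite mxE scale_mulAl.
Qed.

Lemma scale_mulmxr (c : R[i]) m (x : 'M[B]_n) (y : 'M[B]_(n, m)) :
  map_mx ( *:%R c) (x *m y) = x *m map_mx ( *:%R c) y.
Proof.
apply/matrixP => i j; rewrite !mxE scaler_sumr.
by apply: eq_bigr => k _; rewrite mxE scale_mulAr.
Qed.

Lemma col_norm_scale (c : R[i]) (xi : 'cV[B]_n) :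
  col_norm (map_mx ( *:%R c) xi) = complex.Re `|c| * col_norm xi.
Proof.
have c0 := Re_normr_ge0 c.
apply/eqP.
rewrite -(@eqrXn2 _ 2) ?mulr_ge0 ?col_norm_ge0// exprMn !col_norm_sq; apply/eqP.
have -> : inner (map_mx ( *:%R c) xi) (map_mx ( *:%R c) xi) =
    (complex.Re `|c| ^+ 2)%:C *: inner xi xi.
  rewrite !innerE scaler_sumr; apply: eq_bigr => i _; rewrite !mxE starZ.
  rewrite -scale_mulAl -scale_mulAr scalerA rmorphXn/= Re_normrE.
  by rewrite sqr_normc mulrC.
by rewrite cnormZ// exprn_ge0.
Qed.

Fact mx_normZ (c : R[i]) (x : M) : mx_norm (c *: x) = `|c| * mx_norm x.
Proof.
have c0 := Re_normr_ge0 c.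
rewrite -Re_normrE -rmorphM; congr (_%:C).
have le d (y : M) : mxnorm (d *: y : 'M[B]_n) <= complex.Re `|d| * mxnorm (y : 'M[B]_n).
  have d0 := Re_normr_ge0 d.
  apply: mxnorm_le => xi xi1; rewrite -scale_mulmxl col_norm_scale ler_wpM2l//.
  by rewrite (le_trans (mxnorm_ge _ _))// ler_piMr// mxnorm_ge0.
apply/eqP; rewrite eq_le le andTb.
have [->|cN0] := eqVneq c 0; first by rewrite normr0 mul0r mxnorm_ge0.
have := le c^-1 (c *: x); rewrite scalerA mulVf// scale1r.
have nc : complex.Re `|c| != 0.
  apply: contra_neq cN0 => nc0; apply: normr0_eq0.
  by rewrite -Re_normrE nc0.
have -> : complex.Re `|c^-1| = (complex.Re `|c|)^-1.
  by apply: (@real_complexI R); rewrite fmorphV [LHS]Re_normrE normfV -Re_normrE.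
by rewrite mulrC ler_pdivlMr ?lt_neqAle ?(eq_sym 0) ?nc// mulrC.
Qed.

Fact mx_norm0 (x : M) : mx_norm x = 0 -> x = 0.
Proof.
move=> /real_complexI x0; apply/matrixP => i j; rewrite [RHS]mxE.
apply/cnorm0_eq0/eqP; rewrite eq_le cnorm_ge0 andbT -x0.
exact: cnorm_entry_mxnorm.
Qed.

HB.instance Definition _ := Lmodule_isNormed.Build R[i] M mx_normD mx_normZ mx_norm0.

Lemma mxalg_normE (x : M) : `|x| = (mxnorm (x : 'M[B]_n))%:C. Proof. by []. Qed.

Fact mx_complete (F : set_system M) : ProperFilter F -> cauchy F -> cvg F.
Proof.
move=> FF /cauchyP Fc.
have Fij i j : exists b : B, forall e : R, 0 < e ->
    \forall x \near F, cnorm (b - (x : 'M[B]_n) i j) < e.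
  pose f (x : M) := (x : 'M[B]_n) i j.
  have Gc : cauchy (f @ F).
    apply/cauchyP => e e0; have [a Fa] := Fc e e0.
    exists (f a); suff : F (f @^-1` ball (f a) e) by [].
    apply: filterS Fa => b; rewrite -!ball_normE /ball_ /= => ab.
    apply: le_lt_trans ab; rewrite mxalg_normE cnormE lecR.
    by have := cnorm_entry_mxnorm (a - b : 'M[B]_n) i j; rewrite !mxE.
  have GF : ProperFilter (f @ F) by exact: fmap_proper_filter.
  have /cvg_ex[b Gb] := @cauchy_cvg B (f @ F) GF Gc.
  exists b => e e0; have eC : 0 < e%:C by rewrite ltcR.
  have /cvgrPdist_lt /(_ _ eC) := Gb.
  by apply: filterS => x; rewrite cnormE ltcR.
have /choice[a0 Fa] : forall ij : 'I_n * 'I_n, exists b : B, forall e : R, 0 < e ->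
    \forall x \near F, cnorm (b - (x : 'M[B]_n) ij.1 ij.2) < e.
  by move=> [i j]; exact: Fij.
pose a : M := \matrix_(i, j) a0 (i, j).
apply/cvg_ex; exists a; apply/cvgrPdist_lt => e e0.
have e0' : 0 < complex.Re e by move: e0; rewrite ltcE => /andP[_].
have eE : e = (complex.Re e)%:C by rewrite RRe_real// gtr0_real.
(* The successor makes the sum of the n * n entry bounds strictly smaller than e and covers n =
   0. *)
pose d := complex.Re e / (n * n).+1%:R.
have d0 : 0 < d by rewrite divr_gt0.
have Fd := @filter_forall M _ _ F _ (fun ij => Fa ij d d0).

apply: filterS (Fd _) => x xd; rewrite eE mxalg_normE ltcR.
apply: le_lt_trans (mxnorm_le_entry _) _.
apply: (@le_lt_trans _ _ (\sum_(i < n) \sum_(j < n) d)).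
  apply: ler_sum => i _; apply: ler_sum => j _.
  by rewrite !mxE ltW// (xd (i, j)).
rewrite !sumr_const card_ord -mulrnA -mulr_natr /d -mulrA.
by rewrite gtr_pMr// mulrC ltr_pdivrMr// mul1r ltr_nat.
Qed.

HB.instance Definition _ := Uniform_isComplete.Build M mx_complete.

Let mx_mul (x y : M) : M := (x : 'M[B]_n) *m (y : 'M[B]_n).
Let mx_one : M := 1%:M.
Let mx_star (x : M) : M := mxstar (x : 'M[B]_n).

Fact mx_mulA : associative mx_mul. Proof. exact: mulmxA. Qed.
Fact mx_mul1 : left_id mx_one mx_mul. Proof. exact: mul1mx. Qed.
Fact mx_mulr1 : right_id mx_one mx_mul. Proof. exact: mulmx1. Qed.
Fact mx_mulDl : left_distributive mx_mul +%R. Proof. exact: mulmxDl. Qed.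
Fact mx_mulDr : right_distributive mx_mul +%R. Proof. exact: mulmxDr. Qed.
Fact mx_scaleAl (c : R[i]) (x y : M) : c *: mx_mul x y = mx_mul (c *: x) y.
Proof. exact: scale_mulmxl. Qed.
Fact mx_scaleAr (c : R[i]) (x y : M) : c *: mx_mul x y = mx_mul x (c *: y).
Proof. exact: scale_mulmxr. Qed.
Fact mx_normM (x y : M) : `|mx_mul x y| <= `|x| * `|y|.
Proof. by rewrite !mxalg_normE -rmorphM lecR mxnormM. Qed.
Fact mx_starK : involutive mx_star. Proof. exact: mxstarK. Qed.
Fact mx_starD : {morph mx_star : x y / x + y}. Proof. exact: mxstarD. Qed.
Fact mx_starZ (c : R[i]) (x : M) : mx_star (c *: x) = (c^*)%C *: mx_star x.
Proof. by apply/matrixP => i j; rewrite !mxE starZ. Qed.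
Fact mx_starM (x y : M) : mx_star (mx_mul x y) = mx_mul (mx_star y) (mx_star x).
Proof. exact: mxstarM. Qed.
Fact mx_cstar_id (x : M) : `|mx_mul (mx_star x) x| = `|x| ^+ 2.
Proof. by rewrite !mxalg_normE -rmorphXn mxnorm_id. Qed.

HB.instance Definition _ := isUnitalCStarAlgebra.Build R M
  mx_mulA mx_mul1 mx_mulr1 mx_mulDl mx_mulDr mx_scaleAl mx_scaleAr mx_normM
  mx_starK mx_starD mx_starZ mx_starM mx_cstar_id.

HB.instance Definition _ := GRing.PzRing.copy M (M : unitalCStarAlgType R).

Lemma mxalg_mulE (x y : M) : x * y = (x : 'M[B]_n) *m (y : 'M[B]_n).
Proof. by []. Qed.

Lemma mxalg_cnormE (x : M) : cnorm x = mxnorm (x : 'M[B]_n).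
Proof. by apply: (@real_complexI R); rewrite -cnormE. Qed.

End MatrixCStarAlgebra.

(** * Cuntz comparison in a C*-algebra *)

Lemma halving_near (R : realType) (rho : nat -> R) (e : R) : 0 < e ->
  (forall k, rho k.+1 <= rho k / 2) -> \forall k \near \oo, rho k <= e.
Proof.
move=> e0 rho2.
have rhole k : rho k <= `|rho 0%N| * 2^-1 ^+ k.
  elim: k => [|k IH]; first by rewrite expr0 mulr1 ler_norm.
  by have := rho2 k; rewrite exprSr; lra.
have C0 : 0 < `|rho 0%N| + 1 by rewrite ltr_wpDl.
have /cvgrPdist_lt /(_ _ (divr_gt0 e0 C0)) : (2^-1 : R) ^+ n @[n --> \oo] --> 0.
  by apply: cvg_expr; rewrite ger0_norm; lra.
apply: filterS => n; rewrite /= sub0r normrN ger0_norm ?exprn_ge0//; last lra.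
have := rhole n; set q := _ ^+ n; rewrite ltr_pdivlMr//.
have : 0 <= q by rewrite exprn_ge0//; lra.
by lra.
Qed.

Section GeometricSequences.
Context {R : realType} {A : unitalCStarAlgType R}.

Lemma cauchy_halving (u : nat -> A) (rho : nat -> R) :
  (forall k, rho k.+1 <= rho k / 2) ->
  (forall k, cnorm (u k.+1 - u k) <= rho k) ->
  exists2 x, null (fun n => u n - x) & forall k, cnorm (x - u k) <= 2 * rho k.
Proof.
move=> rho2 urho.
have rho0 k : 0 <= rho k by exact: le_trans (cnorm_ge0 _) (urho k).
(* The subtracted term closes the induction: halving means rho m <= 2 (rho m - rho (m + 1)), so the
   bounds telescope. *)
have dist k j : cnorm (u (k + j)%N - u k) <= 2 * (rho k - rho (k + j)%N).
  elim: j => [|j IH]; first by rewrite addn0 !subrr cnorm0 mulr0.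
  rewrite addnS; have := cnormD (u (k + j).+1 - u (k + j)%N) (u (k + j)%N - u k).
  by rewrite addrA subrK; have := urho (k + j)%N; have := rho2 (k + j)%N; lra.
have dist' k m : (k <= m)%N -> cnorm (u m - u k) <= 2 * rho k.
  by move=> /subnKC <-; have := dist k (m - k)%N; have := rho0 (k + (m - k))%N; lra.
have [|x ux] := @cauchy_null _ _ u.
  move=> e e0; have e20 : 0 < e / 2 by lra.
  have [N _ HN] := halving_near e20 rho2; exists N => n m Nn nm.
  by apply: le_trans (dist' _ _ nm) _; have := HN _ Nn; rewrite /=; lra.
exists x => // k.
apply: (@null_norm_le _ _ (fun n => u n - u k)).
  by apply: null_ext ux => n; rewrite opprB addrA subrK.
by exists k => // n /=; exact: dist'.
Qed.

(** [u] runs through the partial sums of the Neumann series of h = 1 - c; its limit satisfies r = 1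
    + h r. Left inverses are obtained from this by taking adjoints. *)
Lemma right_inverse_near1 (c : A) : cnorm (1 - c) <= 2^-1 -> exists r, c * r = 1.
Proof.
set h := 1 - c => h12.
pose u k := iter k (fun x => 1 + h * x) 0; have uS k : u k.+1 = 1 + h * u k by [].
have [||r ur _] := @cauchy_halving u (fun k => 2^-1 ^+ k).
- by move=> k; rewrite exprSr.
- elim=> [|k IH].
    by rewrite /u /= mulr0 addr0 subr0 expr0 cnorm1_le.
  rewrite [u k.+2]uS [X in _ - X]uS opprD addrACA subrr add0r.
  by rewrite -mulrBr exprS (le_trans (cnormM _ _))// ler_pM ?cnorm_ge0.
exists r; apply/eqP; rewrite -subr_eq0; apply/eqP/null_cst.
have ur1 : null (fun n => u n.+1 - r).
  by move=> e /ur[N _ HN]; exists N => // n /= Nn; exact: (HN n.+1 (leqW Nn)).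
apply: null_ext (nullB (null_mull (bounded_cst h) ur) ur1) => n.
rewrite uS mulrBr; set p := h * u n.
have -> : h * r = r - c * r by rewrite /h mulrBl mul1r.
by rewrite -[1 + p - r]addrA [1 + _]addrC opprB addrA addrAC opprD addrACA subrr add0r.
Qed.

End GeometricSequences.

Section CuntzComparison.
Context {R : realType} {A : unitalCStarAlgType R}.
Implicit Types a b c w z : A.

(* Cuntz comparison inside [A] itself, without passing to larger matrices. *)
Definition cle c a := forall e : R, 0 < e ->
  exists z, cnorm (z * a * star z - c) <= e.

(** A conjugate z a z^* that is close to c' is close to c. There is no such closedness in [a],
    because the conjugating element may be large. *)
Lemma cle_closed a c :
  (forall e : R, 0 < e -> exists2 c', cle c' a & cnorm (c' - c) <= e) -> cle c a.
Proof.
move=> H e e0; have e20 : 0 < e / 2 by lra.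
have [c' /(_ _ e20)[z zc'] c'c] := H _ e20; exists z.
by have := cnormD (z * a * star z - c') (c' - c); rewrite addrA subrK; lra.
Qed.

Lemma cle_lim a c (u : nat -> A) : (forall n, cle (u n) a) ->
  null (fun n => u n - c) -> cle c a.
Proof.
move=> ua uc; apply: cle_closed => e /uc /filter_ex[n un].
by exists (u n).
Qed.

Lemma cnorm_conj w x : cnorm (w * x * star w) <= cnorm w ^+ 2 * cnorm x.
Proof.
have := cnormM (w * x) (star w); have := cnormM w x; rewrite cnorm_star.
by have := cnorm_ge0 w; have := cnorm_ge0 x; nra.
Qed.

Lemma conj_continuous w x (r : R) : 0 < r -> exists2 t : R, 0 < t &
  forall y, cnorm (w - y) <= t -> cnorm (y * x * star y - w * x * star w) <= r.
Proof.
move=> r0; have w0 := cnorm_ge0 w; have x0 := cnorm_ge0 x.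
have C0 : 0 < (2 * cnorm w + 1) * (cnorm x + 1) by rewrite mulr_gt0//; lra.
(* The minimum with 1 gives |y| <= |w| + 1, and then the two terms of the difference are at most |y
   - w| (2 |w| + 1) |x| in total. *)
exists (Num.min 1 (r / ((2 * cnorm w + 1) * (cnorm x + 1)))).
  by rewrite lt_min ltr01 divr_gt0.
move=> y; rewrite le_min ler_pdivlMr// => /andP[y1 yr].
have -> : y * x * star y - w * x * star w =
    (y - w) * x * star y + w * x * star (y - w).
  by rewrite starB mulrBr !mulrBl addrA subrK.
have ny := cnormD (y - w) w; rewrite subrK in ny; rewrite (cdistC w) in y1 yr.
have h1 := cnormD ((y - w) * x * star y) (w * x * star (y - w)).
have h2 := cnormM ((y - w) * x) (star y); have h3 := cnormM (y - w) x.
have h4 := cnormM (w * x) (star (y - w)); have h5 := cnormM w x.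
rewrite !cnorm_star in h2 h4; apply: le_trans h1 _.
move: (cnorm_ge0 (y - w)) (cnorm_ge0 y) (cnorm_ge0 (w * x)) => d0 y0 _.
have h6 : cnorm ((y - w) * x * star y) <= cnorm (y - w) * cnorm x * (1 + cnorm w).
  apply: le_trans h2 _; rewrite ler_pM ?cnorm_ge0//; lra.
have h7 : cnorm (w * x * star (y - w)) <= cnorm w * cnorm x * cnorm (y - w).
  by apply: le_trans h4 _; rewrite ler_wpM2r.
move: h6 h7 yr d0 y1; set p := cnorm (y - w); set q := cnorm w in w0 *.
set t := cnorm x in x0 *; move=> h6 h7 yr d0 y1.
have : 0 <= p * q by rewrite mulr_ge0.
have : 0 <= p * q * t by rewrite !mulr_ge0.
have : 0 <= p * t by rewrite mulr_ge0.
by rewrite mulrDl !mulrDr in yr *; lra.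
Qed.

Lemma conjB w x y : w * x * star w - w * y * star w = w * (x - y) * star w.
Proof. by rewrite mulrBr mulrBl. Qed.

Lemma cle_self_conj a z : cle (z * a * star z) a.
Proof. by move=> e e0; exists z; rewrite subrr cnorm0 ltW. Qed.

Lemma cle_conj w c a : cle c a -> cle (w * c * star w) a.
Proof.
move=> ca e e0; have W0 : 0 < cnorm w ^+ 2 + 1 by have := sqr_ge0 (cnorm w); lra.
have [z zc] := ca _ (divr_gt0 e0 W0); exists (w * z).
have -> : w * z * a * star (w * z) = w * (z * a * star z) * star w.
  by rewrite starM !mulrA.
rewrite conjB (le_trans (cnorm_conj _ _))//; move: zc; rewrite ler_pdivlMr//.
by have := cnorm_ge0 (z * a * star z - c); have := sqr_ge0 (cnorm w); nra.
Qed.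

Lemma cle_trans b c a : cle c b -> cle b a -> cle c a.
Proof.
move=> cb ba; apply: cle_closed => e /cb[z zb].
by exists (z * b * star z) => //; exact: cle_conj.
Qed.

Lemma cle_pos a c : pos a -> cle c a -> pos c.
Proof.
move=> ap ca.
have /choice[z zP] n : exists z, cnorm (z * a * star z - c) <= n.+1%:R^-1.
  by apply: ca; rewrite invr_gt0.
apply: (@pos_lim _ _ (fun n => z n * a * star (z n))).
  by move=> n; have := pos_conj (star (z n)) ap; rewrite starK.
move=> e e0; have /cvgrPdist_lt/(_ _ e0) := @cvg_harmonic R.
apply: filterS => n; rewrite sub0r normrN ger0_norm ?harmonic_ge0// => /ltW.
exact: le_trans (zP n).
Qed.

End CuntzComparison.

Lemma cle_hom (R : realType) (A B : unitalCStarAlgType R) (phi : starHom A B) c a :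
  cle c a -> cle (phi c) (phi a).
Proof.
move=> ca e e0; have e20 : 0 < e / 2 by lra.
have [z zc] := ca _ e20; exists (phi z).
have := starhom_bounded phi (z * a * star z - c).
by rewrite raddfB/= !starhomM starhomS; lra.
Qed.

(** * Averaging along Rokhlin towers *)

Section RokhlinTowers.
Context {R : realType} {gT : finGroupType} {A : unitalCStarAlgType R}.
Variable alpha : cstarAction gT A.
Implicit Types (a b : A) (x y z : gT -> A) (e : nat -> gT -> A).

Definition fixed a := forall g, alpha g a = a.

Definition commutes e a := forall g, null (fun n => e n g * a - a * e n g).

(** A sequence of Rokhlin projections with tolerance tending to 0: the relations that are exact in
    the Rokhlin property stay exact for each n, the approximate ones become null sequences. *)
Record rokhlin_tower e : Prop := RokhlinTower {
  tower_proj : forall n g, is_projection (e n g);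
  tower_orth : forall n g h, g != h -> e n g * e n h = 0;
  tower_sum : forall n, \sum_g e n g = 1;
  tower_shift : forall g h, null (fun n => alpha g (e n h) - e n (g * h)%g)
}.

Lemma rokhlin_tower_ex (s : seq A) : rokhlin_property alpha ->
  exists2 e, rokhlin_tower e & forall a, a \in s -> commutes e a.
Proof.
move=> alphaR.
have /choice[e eP] n := alphaR [set` s] n.+1%:R^-1 (finite_seq s) ltac:(by rewrite invr_gt0).
have small (u : nat -> A) : (forall n, cnorm (u n) < n.+1%:R^-1) -> null u.
  move=> un r r0; have /cvgrPdist_lt/(_ _ r0) := @cvg_harmonic R.
  apply: filterS => n; rewrite sub0r normrN ger0_norm ?harmonic_ge0// => /ltW.
  exact/le_trans/ltW/un.
exists e.
  split; try by move=> n; case: (eP n).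
  by move=> g h; apply: small => n; case: (eP n).
by move=> a sa g; apply: small => n; case: (eP n) => _ _ _ + _; exact.
Qed.

Lemma commutes_star e a : rokhlin_tower e -> commutes e a -> commutes e (star a).
Proof.
move=> te ea g; apply: null_ext (nullN (null_star (ea g))) => n.
by have [es _] := tower_proj te n g; rewrite starB !starM es opprB.
Qed.

(** Seen as a map from families [gT -> A] to [A], this is asymptotically multiplicative on families
    that commute with the tower, and asymptotically the identity on constant families commuting with
    it. Averages are computed by comparison with the compression of the orbit
    [fun g => alpha g a]. *)
Definition compress e n x : A := \sum_g e n g * x g * e n g.

(** Translating the single corner at 1 makes the result exactly fixed for every n, whereas the
    compression of an orbit is only approximately fixed. *)
Definition average e n a : A := \sum_g alpha g (e n 1%g * a * e n 1%g).

Section Tower.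
Variable e : nat -> gT -> A.
Hypothesis te : rokhlin_tower e.

Lemma cnorm_tower n g : cnorm (e n g) <= 1.
Proof.
have [es ee] := tower_proj te n g; have := cnorm_id (e n g).
by rewrite es ee; have := cnorm_ge0 (e n g); nra.
Qed.

Lemma bounded_tower g : bounded (fun n => e n g).
Proof. by exists 1 => n; exact: cnorm_tower. Qed.

(** The triangle inequality over the tower is accurate enough here; the factor [#|gT|] reappears as
    [N] in the constants below. *)
Lemma compress_norm n x (C : R) : (forall g, cnorm (x g) <= C) ->
  cnorm (compress e n x) <= #|gT|%:R * C.
Proof.
move=> xC; apply: le_trans (cnorm_sum _ _) _.
rewrite mulr_natl -sumr_const ler_sum// => g _.
have := cnormM (e n g * x g) (e n g); have := cnormM (e n g) (x g).
have := cnorm_tower n g; have := xC g; have := cnorm_ge0 (x g).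
have := cnorm_ge0 (e n g); have := cnorm_ge0 (e n g * x g).
by nra.
Qed.

Lemma bounded_compress x : bounded (fun n => compress e n x).
Proof.
exists (#|gT|%:R * \sum_g cnorm (x g)) => n; apply: compress_norm => g.
by rewrite (bigD1 g)//= ler_wpDr// sumr_ge0// => h _; exact: cnorm_ge0.
Qed.

Lemma compressB n x y : compress e n x - compress e n y =
  compress e n (fun g => x g - y g).
Proof. by rewrite -sumrB; apply: eq_bigr => g _; rewrite mulrBr mulrBl. Qed.

Lemma star_compress n x : star (compress e n x) = compress e n (fun g => star (x g)).
Proof.
rewrite (big_morph _ starD star0); apply: eq_bigr => g _.
by have [es _] := tower_proj te n g; rewrite !starM es mulrA.
Qed.

(** Orthogonality kills the cross terms. On the diagonal the error is e_g x_g [e_g, y_g] e_g, so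
    only the right factor has to commute with the tower. *)
Lemma compressM x y : (forall g, commutes e (y g)) ->
  null (fun n => compress e n x * compress e n y - compress e n (fun g => x g * y g)).
Proof.
move=> ey; pose u g n := e n g * x g * (e n g * y g - y g * e n g) * e n g.
have u0 g : null (u g).
  apply: null_mulr (bounded_tower g); apply: null_mull (ey g g).
  exact: boundedM (bounded_tower g) (bounded_cst _).
apply: null_ext (null_sum (index_enum gT) u0) => n.
rewrite /compress mulr_suml -sumrB; apply: eq_bigr => g _.
rewrite mulr_sumr (bigD1 g)//= big1 ?addr0 => [|h hg]; last first.
  by rewrite -!mulrA [e n g * (e n h * _)]mulrA (tower_orth te) 1?eq_sym// mul0r !mulr0.
have [_ ee] := tower_proj te n g.
rewrite /u mulrBr mulrBl -!mulrA ee [e n g * (e n g * _)]mulrA ee.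
by rewrite ?mulrA.
Qed.

Lemma compress_cst a : commutes e a -> null (fun n => compress e n (fun=> a) - a).
Proof.
move=> ea; pose u g n := (e n g * a - a * e n g) * e n g.
have u0 g : null (u g) by exact: null_mulr (ea g) (bounded_tower g).
apply: null_ext (null_sum (index_enum gT) u0) => n.
rewrite -[X in _ = _ - X]mulr1 -(tower_sum te n) mulr_sumr -sumrB.
apply: eq_bigr => g _; have [_ ee] := tower_proj te n g.
by rewrite /u mulrBl -[a * _ * _]mulrA ee.
Qed.

Lemma average_fixed n a : fixed (average e n a).
Proof.
move=> h; rewrite /average raddf_sum/= [RHS](reindex_inj (mulgI h))/=.
by apply: eq_bigr => g _; rewrite -actionM.
Qed.

(** [tower_shift] at h = 1 says that alpha_g(e_1) is asymptotically e_g. *)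
Lemma average_compress a :
  null (fun n => average e n a - compress e n (fun g => alpha g a)).
Proof.
pose u g n := alpha g (e n 1%g) * alpha g a * alpha g (e n 1%g)
  - e n g * alpha g a * e n g.
have u0 g : null (u g).
  have s := tower_shift te g 1; rewrite mulg1 in s.
  have be : bounded (fun n => alpha g (e n 1%g)).
    exists (2 * 1) => n; apply: le_trans (starhom_bounded _ _) _.
    by rewrite ler_wpM2l// cnorm_tower.
  have bg := bounded_tower g; have ba := bounded_cst (alpha g a).
  apply: nullM_sub => //; first exact: boundedM.
  apply: nullM_sub => //; first exact: null_ext (fun=> esym (subrr _)) null0.
apply: null_ext (null_sum (index_enum gT) u0) => n.
by rewrite -sumrB; apply: eq_bigr => g _; rewrite !starhomM.
Qed.

Lemma average_norm n a : cnorm (average e n a) <= #|gT|%:R * (2 * cnorm a).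
Proof.
apply: le_trans (cnorm_sum _ _) _.
rewrite mulr_natl -sumr_const ler_sum// => g _.
apply: le_trans (starhom_bounded _ _) _.
have := cnormM (e n 1%g * a) (e n 1%g); have := cnormM (e n 1%g) a.
have := cnorm_tower n 1; have := cnorm_ge0 a.
have := cnorm_ge0 (e n 1%g); have := cnorm_ge0 (e n 1%g * a).
by nra.
Qed.

Lemma bounded_average a : bounded (fun n => average e n a).
Proof. by exists (#|gT|%:R * (2 * cnorm a)) => n; exact: average_norm. Qed.

Lemma compress_conj z x : (forall g, commutes e (x g)) -> (forall g, commutes e (z g)) ->
  null (fun n => compress e n z * compress e n x * star (compress e n z)
    - compress e n (fun g => z g * x g * star (z g))).
Proof.
move=> ex ez; have ezs g : commutes e (star (z g)) by exact: commutes_star.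
have bz := bounded_compress z; have bx := bounded_compress x.
apply: null_trans (compressM (fun g => z g * x g) ezs).
apply: null_ext (null_mulr (compressM z ex) (bounded_star bz)) => n.
by rewrite mulrBl !star_compress.
Qed.

End Tower.

End RokhlinTowers.

Definition invertibles_dense (R : realType) (A : unitalCStarAlgType R) :=
  forall (x : A) (eps : R), 0 < eps ->
    exists y z, [/\ y * z = 1, z * y = 1 & cnorm (x - y) <= eps].

(** * Comparison of fixed elements through fixed elements *)

Section RokhlinComparison.
Context {R : realType} {gT : finGroupType} {A : unitalCStarAlgType R}.
Variable alpha : cstarAction gT A.
Hypothesis alphaR : rokhlin_property alpha.
Implicit Types (a b c d : A) (x y z : gT -> A) (e : nat -> gT -> A).

Local Notation N := (#|gT|%:R : R).
Local Notation fixed := (fixed alpha).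

Lemma order_gt0 : 0 < N.
Proof. by rewrite ltr0n; apply/card_gt0P; exists 1%g. Qed.

(** The strict gap between r and s absorbs the null error. This is why tolerances below are divided
    by a further factor, for example r / (4 N), which makes N (2 r1) equal to r / 2. *)
Lemma null_near (u v : nat -> A) (r s : R) : r < s -> null (fun n => u n - v n) ->
  (forall n, cnorm (v n) <= r) -> \forall n \near \oo, cnorm (u n) <= s.
Proof.
move=> rs uv vr; have rs0 : 0 < s - r by lra.
apply: filterS (uv _ rs0) => n un.
by have := cnormD (u n - v n) (v n); rewrite subrK; have := vr n; lra.
Qed.

Lemma fixed_compress_dist e c d n (r : R) : rokhlin_tower alpha e -> fixed d ->
  cnorm (c - d) <= r ->
  cnorm (compress e n (fun g => alpha g c) - compress e n (fun=> d)) <= N * (2 * r).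
Proof.
move=> te df cd; rewrite compressB; apply: (compress_norm te) => g.
rewrite -{1}(df g) -raddfB (le_trans (starhom_bounded _ _))//.
by rewrite ler_wpM2l.
Qed.

Lemma average_near e c d (r s : R) : rokhlin_tower alpha e -> fixed d ->
  commutes e d -> cnorm (c - d) <= r -> N * (2 * r) < s ->
  \forall n \near \oo, cnorm (average alpha e n c - d) <= s.
Proof.
move=> te df ed cd rs.
apply: (null_near rs) (fun n => fixed_compress_dist n te df cd).
exact: null_sub2 (average_compress te c) (null_sym (compress_cst te ed)).
Qed.

(** As b is fixed, conjugating it by the average of v gives asymptotically the compression of the
    orbit of v b v^*. As a is fixed, that orbit stays uniformly close to the constant family a. *)
Lemma cle_fixed a b : fixed a -> fixed b -> cle a b ->
  forall r : R, 0 < r -> exists2 v, fixed v & cnorm (v * b * star v - a) <= r.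
Proof.
move=> af bf ab r r0; have N0 := order_gt0.
pose r1 := r / (4 * N); have r10 : 0 < r1 by rewrite divr_gt0// mulr_gt0.
have [v vb] := ab _ r10.
have [e te es] := rokhlin_tower_ex
  (b :: a :: codom (fun g => alpha g v)) alphaR.
have eb : commutes e b by apply: es; rewrite !inE eqxx.
have ea : commutes e a by apply: es; rewrite !inE eqxx orbT.
have ev g : commutes e (alpha g v) by apply: es; rewrite !inE codom_f !orbT.
have bP := @bounded_compress _ _ _ alpha e te.
have H1 : null (fun n => average alpha e n v * b * star (average alpha e n v) -
    compress e n (fun g => alpha g (v * b * star v))).
  have H2 := compress_conj te (fun=> eb) ev.
  have H3 := null_conj (bounded_average te v) (bP _) (bounded_cst b) (bP (fun=> b))
    (average_compress te v) (null_sym (compress_cst te eb)).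
  apply: null_ext (null_trans H3 H2) => n; congr (_ - compress e n _).
  by apply/funext => g; rewrite !starhomM starhomS bf.
have : \forall n \near \oo,
    cnorm (average alpha e n v * b * star (average alpha e n v) - a) <= r.
  have rs : N * (2 * r1) < r.
    have -> : N * (2 * r1) = r / 2 by rewrite /r1; field; lra.
    by lra.
  apply: (null_near rs) (fun n => fixed_compress_dist n te af vb).
  exact: null_sub2 H1 (null_sym (compress_cst te ea)).
move=> /filter_ex[n Hn]; exists (average alpha e n v) => //.
exact: average_fixed.
Qed.

End RokhlinComparison.

(** * Fixed representatives of invariant Cuntz classes *)

Section RokhlinSurjectivity.
Context {R : realType} {gT : finGroupType} {A : unitalCStarAlgType R}.
Variable alpha : cstarAction gT A.
Hypothesis alphaR : rokhlin_property alpha.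
Implicit Types (a b c d : A) (e : nat -> gT -> A).

Local Notation N := (#|gT|%:R : R).
Local Notation fixed := (fixed alpha).

Lemma fixed1 : fixed 1.
Proof. by move=> g; exact: action_hom1. Qed.

Lemma fixed_star_conj w a : fixed w -> fixed a -> fixed (w * a * star w).
Proof. by move=> wf af g; rewrite !starhomM starhomS wf af. Qed.

Lemma fixed_lim (u : nat -> A) a : (forall n, fixed (u n)) ->
  null (fun n => u n - a) -> fixed a.
Proof.
move=> uf ua g; apply/eqP; rewrite -subr_eq0; apply/eqP/null_cst.
apply: null_ext (nullB ua (null_hom (alpha g) ua)) => n.
by rewrite raddfB/= uf opprB addrC addrA subrK.
Qed.

(** An invertible y near a is averaged together with its inverse z. Both products of the averages
    are near 1, because asymptotically they are compressions of the constant family 1. *)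
Lemma fixed_invertible (Ad : invertibles_dense A) a (r : R) : fixed a -> 0 < r ->
  exists y z : A, [/\ fixed y, y * z = 1, z * y = 1 & cnorm (a - y) <= r].
Proof.
move=> af r0; have N0 := order_gt0 (R := R) (gT := gT).
pose r1 := r / (4 * N); have r10 : 0 < r1 by rewrite divr_gt0// mulr_gt0.
have [y [z [yz zy ay]]] := Ad a _ r10.
have [e te es] := rokhlin_tower_ex
  (a :: codom (fun g => alpha g y) ++ codom (fun g => alpha g z)) alphaR.
have ea : commutes e a by apply: es; rewrite !inE eqxx.
have ey g : commutes e (alpha g y) by apply: es; rewrite inE mem_cat codom_f orbT.
have ez g : commutes e (alpha g z) by apply: es; rewrite inE mem_cat codom_f !orbT.
have e1 : commutes e 1.
  by move=> g; apply: null_ext null0 => n; rewrite mulr1 mul1r subrr.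
have inv (y' z' : A) : y' * z' = 1 -> (forall g, commutes e (alpha g z')) ->
    \forall n \near \oo,
      cnorm (1 - average alpha e n y' * average alpha e n z') <= 2^-1.
  move=> yz' ez'.
  have h1 := nullM_sub (bounded_compress te _) (bounded_average te z')
    (average_compress te y') (average_compress te z').
  have h2 := null_trans h1 (compressM te (fun g => alpha g y') ez').
  have h3 : null (fun n => average alpha e n y' * average alpha e n z' - 1).
    apply: null_trans h2 _; apply: null_ext (compress_cst te e1) => n.
    by congr (compress e n _ - _); apply/funext => g; rewrite -starhomM yz' action_hom1.
  by apply: filterS (h3 2^-1 _) => [n|]; [rewrite cdistC|lra].
have rs : N * (2 * r1) < r.
  have -> : N * (2 * r1) = r / 2 by rewrite /r1; field; lra.
  by lra.
rewrite cdistC in ay.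
have near_a := average_near te af ea ay rs.
have [n [[n1 n2] n3]] := filter_ex
  (filterI (filterI (inv _ _ yz ez) (inv _ _ zy ey)) near_a).
have [p wp] := right_inverse_near1 n1.
(* A right inverse of the adjoint is the adjoint of a left inverse; with [p] this makes the average
   of y invertible on both sides. *)
have [|q qw] := @right_inverse_near1 _ _ (star (average alpha e n z * average alpha e n y)).
  by rewrite -star1 -starB cnorm_star.
set w := average alpha e n y in n1 n2 n3 wp qw.
set w' := average alpha e n z in n1 n2 wp qw.
have lq : star q * w' * w = 1.
  by rewrite -mulrA -[LHS]starK starM starK qw star1.
have rp : w * (w' * p) = 1 by rewrite mulrA.
exists w, (w' * p); split => //; first exact: average_fixed.
  suff -> : w' * p = star q * w' by [].
  by rewrite -[LHS]mul1r -lq -!mulrA [w * _]mulrA -[w * w' * p]mulrA rp mulr1.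
by rewrite cdistC.
Qed.

Section Comparable.
Variable a : A.
Hypothesis aI : forall g, cle (alpha g a) a.

Lemma cle_alpha c g : cle c a -> cle (alpha g c) a.
Proof. by move=> /(cle_hom (alpha g))/cle_trans; apply. Qed.

(** Compressing the conjugators z_g into one element gives c' = z a z^*, which lies exactly below a.
    The list [s] is returned so that a caller can ask one tower to commute with further elements
    too. *)
Lemma compress_cle (c : gT -> A) (r : R) : (forall g, cle (c g) a) -> 0 < r ->
  exists s : seq A, forall e, rokhlin_tower alpha e ->
    (forall b, b \in s -> commutes e b) ->
    \forall n \near \oo, exists2 c', cle c' a & cnorm (compress e n c - c') <= r.
Proof.
move=> ca r0; have N0 := order_gt0 (R := R) (gT := gT).
pose r1 := r / (2 * N); have r10 : 0 < r1 by rewrite divr_gt0// mulr_gt0.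
have /choice[z zP] g : exists z, cnorm (z * a * star z - c g) <= r1 by exact: ca.
exists (a :: codom z) => e te es.
have ea : commutes e a by apply: es; rewrite inE eqxx.
have ez g : commutes e (z g) by apply: es; rewrite inE codom_f orbT.
pose c' n := compress e n z * a * star (compress e n z).
suff : \forall n \near \oo, cnorm (compress e n c - c' n) <= r.
  by apply: filterS => n cn; exists (c' n) => //; exact: cle_self_conj.
have bP := bounded_compress te.
have h1 := null_conj (bP z) (bP z) (bounded_cst a) (bP (fun=> a))
  (null_self _) (null_sym (compress_cst te ea)).
have h2 := null_trans h1 (compress_conj te (fun=> ea) ez).
have rs : N * r1 < r.
  have -> : N * r1 = r / 2 by rewrite /r1; field; lra.
  by lra.
apply: null_near rs (null_sub2 (null_self _) h2) _ => n.
rewrite compressB; apply: (compress_norm te) => g.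
by rewrite cdistC.
Qed.

(** [d'] is the average of c. Its distance to the set below a is as small as desired, while its
    distance to d is controlled by r alone. The extra 1 in the constant provides the strict
    inequality required by [average_near]. *)
Lemma average_cle c d (r r' : R) : fixed d -> cle c a -> 0 < r ->
  cnorm (c - d) <= r -> 0 < r' ->
  exists d', [/\ fixed d', exists2 c', cle c' a & cnorm (c' - d') <= r'
    & cnorm (d' - d) <= (2 * N + 1) * r].
Proof.
move=> df ca r0 cd r'0; have r'20 : 0 < r' / 2 by lra.
have [s sP] := compress_cle (fun g => cle_alpha g ca) r'20.
have [e te es] := rokhlin_tower_ex (d :: s) alphaR.
have ed : commutes e d by apply: es; rewrite inE eqxx.
have {}sP := sP e te (fun b bs => es b (mem_behead (s := d :: s) bs)).
have rs : N * (2 * r) < (2 * N + 1) * r by lra.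
have [n [[[c' c'a c'c] n2] n3]] := filter_ex
  (filterI (filterI sP (average_compress te c r'20)) (average_near te df ed cd rs)).
exists (average alpha e n c); split => //; first exact: average_fixed.
exists c' => //; rewrite cdistC.
have := cnormD (average alpha e n c - compress e n (fun g => alpha g c))
  (compress e n (fun g => alpha g c) - c').
by rewrite addrA subrK; lra.
Qed.

(** Iterating [average_cle] with r halved each time moves the point by at most 2 (N + 1) r / 2^k at
    step k, hence by 4 (N + 1) r in total. The distances to the closed set below a tend to 0, so the
    limit belongs to it. A pair in [Good] is a point with its current tolerance. *)
Lemma fixed_cle_near c d (r : R) : fixed d -> cle c a -> 0 < r -> cnorm (c - d) <= r ->
  exists d', [/\ fixed d', cle d' a & cnorm (d' - d) <= 4 * (N + 1) * r].
Proof.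
move=> df ca r0 cd; have N0 := order_gt0 (R := R) (gT := gT).
pose Good (p : A * R) := [/\ fixed p.1, 0 < p.2
    & exists2 c, cle c a & cnorm (c - p.1) <= p.2].
have /choice[f fP] : forall p : A * R, exists d',
    Good p -> Good (d', p.2 / 2) /\ cnorm (d' - p.1) <= 2 * (N + 1) * p.2.
  move=> [d1 r1]; have [[/= df1 r10 [c1 ca1 cd1]]|nG] := pselect (Good (d1, r1));
    last by exists 0.
  have r120 : 0 < r1 / 2 by lra.
  have [d' [d'f d'c d'd]] := average_cle df1 ca1 r10 cd1 r120.
  by exists d' => _; split=> //; nra.
pose u := fix u n := if n is n'.+1 then (f (u n'), (u n').2 / 2) else (d, r).
have uG n : Good (u n).
  elim: n => [|n IH]; first by split=> //; exists c.
  by have [] := fP _ IH.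
have [||d' ud' d'd] := @cauchy_halving _ _ (fun n => (u n).1)
  (fun n => 2 * (N + 1) * (u n).2).
- by move=> k /=; rewrite mulrA.
- by move=> k; have [] := fP _ (uG k).
exists d'; split.
- by apply: fixed_lim ud' => n; case: (uG n).
- apply: cle_closed => s s0.
  have s20 : 0 < s / 2 by lra.
  have uh k : (u k.+1).2 <= (u k).2 / 2 by [].
  have [n [n1 n2]] := filter_ex (filterI (halving_near s20 uh) (ud' _ s20)).
  have [_ _ [c' c'a c'u]] := uG n; exists c' => //.
  by have := cnormD (c' - (u n).1) ((u n).1 - d'); rewrite addrA subrK; lra.
- by have := d'd 0%N; rewrite /=; lra.
Qed.

Lemma dense_step (Ad : invertibles_dense A) d (r s : R) :
  fixed d -> cle d a -> 0 < r -> 0 < s ->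
  exists d' v : A, [/\ fixed d', cle d' a, cnorm (d' - d) <= r
    & cnorm (v * d' * star v - a) <= s].
Proof.
move=> df da r0 s0; have N0 := order_gt0 (R := R) (gT := gT).
pose r1 := r / (8 * N); have r10 : 0 < r1 by rewrite divr_gt0// mulr_gt0.
have [z zd] := da _ r10.
pose s1 := s / (4 * N); have s10 : 0 < s1 by rewrite divr_gt0// mulr_gt0.
(* Applying alpha_g to the comparison of alpha_{g^-1}(a) with a reverses it: a lies below every
   alpha_g(a). The compression of these v_g then conjugates the average of a back to approximately
   a. *)
have /choice[v vP] g : exists v, cnorm (v * alpha g a * star v - a) <= s1.
  have /(cle_hom (alpha g)) := aI g^-1.
  by rewrite -actionM mulgV action1; apply.
(* K and L bound the average of z and the compression of v for all n, so t can be fixed before the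
   tower. Moving b by t costs at most r / 4 under conjugation by the former and s / 2 under
   conjugation by the latter; t1 below offsets the constant 4 (N + 1) of [fixed_cle_near]. *)
pose K := N * (2 * cnorm z); pose L := N * \sum_g cnorm (v g).
have K20 := sqr_ge0 K; have L20 := sqr_ge0 L.
pose t := Num.min (s / (2 * (L ^+ 2 + 1))) (r / (4 * (K ^+ 2 + 1))).
have t0 : 0 < t by rewrite lt_min !divr_gt0// mulr_gt0//; lra.
have ts : L ^+ 2 * t <= s / 2.
  have : t <= s / (2 * (L ^+ 2 + 1)) by rewrite ge_min lexx.
  by rewrite ler_pdivlMr ?mulr_gt0//; [nra|lra].
have tr : K ^+ 2 * t <= r / 4.
  have : t <= r / (4 * (K ^+ 2 + 1)) by rewrite ge_min lexx orbT.
  by rewrite ler_pdivlMr ?mulr_gt0//; [nra|lra].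
pose t1 := t / (4 * (N + 1)).
have t10 : 0 < t1 by rewrite divr_gt0// mulr_gt0//; lra.
have t120 : 0 < t1 / 2 by lra.
have [l lP] := compress_cle aI t120.
have [e te es] := rokhlin_tower_ex (a :: d :: (codom v ++
  codom (fun g => alpha g z) ++ codom (fun g => alpha g a) ++ l)) alphaR.
have ea : commutes e a by apply: es; rewrite !inE eqxx.
have ed : commutes e d by apply: es; rewrite !inE eqxx orbT.
have ev g : commutes e (v g) by apply: es; rewrite !inE !mem_cat codom_f !orbT.
have ez g : commutes e (alpha g z).
  by apply: es; rewrite !inE !mem_cat (codom_f (fun g => alpha g z)) !orbT.
have eA g : commutes e (alpha g a).
  by apply: es; rewrite !inE !mem_cat (codom_f (fun g => alpha g a)) !orbT.
have {}lP := lP e te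
  (fun b bl => es b ltac:(by rewrite !inE !mem_cat bl !orbT)).
have bP := bounded_compress te; have bA := bounded_average te.
have near_v : \forall n \near \oo,
    cnorm (compress e n v * average alpha e n a * star (compress e n v) - a) <= s / 2.
  have h1 := null_conj (bP v) (bP v) (bA a) (bP _) (null_self _) (average_compress te a).
  have h2 := null_trans h1 (compress_conj te eA ev).
  have rs : N * s1 < s / 2.
    have -> : N * s1 = s / 4 by rewrite /s1; field; lra.
    by lra.
  apply: null_near rs (null_sub2 h2 (null_sym (compress_cst te ea))) _ => n.
  by rewrite compressB; exact: (compress_norm te).
have near_z : \forall n \near \oo,
    cnorm (average alpha e n z * average alpha e n a *
      star (average alpha e n z) - d) <= r / 2.
  have h1 := null_conj (bA z) (bP _) (bA a) (bP _) (average_compress te z)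
    (average_compress te a).
  have h2 := null_trans h1 (compress_conj te eA ez).
  have rs : N * (2 * r1) < r / 2.
    have -> : N * (2 * r1) = r / 4 by rewrite /r1; field; lra.
    by lra.
  apply: (null_near rs) (fun n => fixed_compress_dist n te df zd).
  apply: null_sub2 (null_sym (compress_cst te ed)).
  apply: null_ext h2 => n; congr (_ - compress e n _); apply/funext => g.
  by rewrite !starhomM starhomS.
have [n [[[[c' c'a n1] n2] n3] n4]] := filter_ex (filterI (filterI (filterI lP
  (average_compress te a t120)) near_v) near_z).
move: n1 n2 n3 n4 (average_norm te n z) (@average_fixed _ _ _ alpha e n z)
  (@average_fixed _ _ _ alpha e n a).
rewrite -/K; set w := average alpha e n z; set b := average alpha e n a.
set ca := compress e n _; set V := compress e n v.
move=> n1 n2 n3 n4 wK wf bf.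
have VL : cnorm V <= L.
  apply: (compress_norm te) => g.
  by rewrite (bigD1 g)//= ler_wpDr// sumr_ge0// => h _; exact: cnorm_ge0.
have c'b : cnorm (c' - b) <= t1.
  by rewrite cdistC; have := cnormD (b - ca) (ca - c'); rewrite addrA subrK; lra.
have [b' [b'f b'a b'b]] := fixed_cle_near bf c'a t10 c'b.
have {}b'b : cnorm (b' - b) <= t.
  by apply: le_trans b'b _; rewrite mulrC divfK//; lra.
have conj_le u (M : R) : 0 <= M -> cnorm u <= M ->
    cnorm (u * b' * star u - u * b * star u) <= M ^+ 2 * t.
  move=> M0 uM; rewrite conjB (le_trans (cnorm_conj _ _))//.
  by rewrite ler_pM ?exprn_ge0 ?cnorm_ge0// lerXn2r ?nnegrE ?cnorm_ge0.
have r40 : 0 < r / 4 by lra.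
have [th th0 thP] := conj_continuous w b' r40.
have [y [y' [yf yy' y'y wy]]] := fixed_invertible Ad wf th0.
have {}thP := thP _ wy.
(* The inverse y' cancels y exactly, so V b' V^* is recovered whatever the norm of y'. Closeness to
   d is the sum of r / 4 for replacing w by y, r / 4 for replacing b by b', and r / 2 from
   [near_z]. *)
exists (y * b' * star y), (V * y'); split.
- exact: fixed_star_conj.
- exact: cle_conj.
- have := conj_le w K (mulr_ge0 (ltW N0) (mulr_ge0 (ler0n _ 2) (cnorm_ge0 z))) wK.
  have := cnormD (y * b' * star y - w * b' * star w) (w * b' * star w - d).
  have := cnormD (w * b' * star w - w * b * star w) (w * b * star w - d).
  by rewrite !addrA !subrK; lra.
- have -> : V * y' * (y * b' * star y) * star (V * y') = V * b' * star V.
    rewrite starM !mulrA -[V * y' * y]mulrA y'y mulr1.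
    by rewrite -[_ * star y * _]mulrA -starM y'y star1 mulr1.
  have := conj_le V L (le_trans (cnorm_ge0 V) VL) VL.
  have := cnormD (V * b' * star V - V * b * star V) (V * b * star V - a).
  by rewrite !addrA !subrK; lra.
Qed.

Lemma fixed_representative (Ad : invertibles_dense A) :
  exists d, [/\ fixed d, cle d a & cle a d].
Proof.
pose Good (p : A * R) := [/\ fixed p.1, cle p.1 a & 0 < p.2].
pose hs n : R := 2^-1 ^+ n.
have hs0 n : 0 < hs n by rewrite exprn_gt0//; lra.
(* The first component is the approximant, the second the length allowed for the next step. Since
   lengths at least halve, the limit lies within 2 q.2 of q.1, which is the ball on which v has to
   work. *)
pose Next n (p q : A * R) := [/\ Good q, q.2 <= p.2 / 2, cnorm (q.1 - p.1) <= p.2 &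
  exists v, forall d, cnorm (d - q.1) <= 2 * q.2 -> cnorm (v * d * star v - a) <= hs n].
have /choice[f fP] : forall p : nat * (A * R), exists q, Good p.2 -> Next p.1 p.2 q.
  move=> [n [d r]]; have [[/= df da r0]|nG] := pselect (Good (d, r)); last by exists (0, 0).
  have h20 : 0 < hs n / 2 by have := hs0 n; lra.
  have [d' [v [d'f d'a d'd vd']]] := dense_step Ad df da r0 h20.
  (* With r' <= hs n / C, a displacement of 2 r' changes the conjugate by v by at most hs n / 2,
     which is what [dense_step] has left over. *)
  pose C := 4 * (cnorm v ^+ 2 + 1).
  have C0 : 0 < C by rewrite mulr_gt0//; have := sqr_ge0 (cnorm v); lra.
  pose r' := Num.min (r / 2) (hs n / C).
  have r'0 : 0 < r' by rewrite lt_min !divr_gt0// hs0.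
  exists (d', r') => _; split => //=; first by rewrite ge_min lexx.
  exists v => d1 d1d'.
  have r'h : r' * C <= hs n by rewrite -ler_pdivlMr// ge_min lexx orbT.
  have := cnorm_conj v (d1 - d'); rewrite -conjB.
  have := cnormD (v * d1 * star v - v * d' * star v) (v * d' * star v - a).
  have := ler_wpM2l (sqr_ge0 (cnorm v)) d1d'.
  by rewrite addrA subrK; move: r'h r'0; rewrite /C; lra.
(* The iteration starts at 0, which is fixed and lies below every element. *)
pose u := fix u n := if n is n'.+1 then f (n', u n') else (0, 1).
have u0G : Good (u 0%N).
  split=> //; first by move=> g; rewrite raddf0.
  by move=> e e0; exists 0; rewrite !mul0r subr0 cnorm0 ltW.
have uG n : Good (u n) by elim: n => [//|n IH]; have [] := fP (n, u n) IH.
have [||d ud d_near] := @cauchy_halving _ _ (fun n => (u n).1) (fun n => (u n).2).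
- by move=> k; have [] := fP (k, u k) (uG k).
- by move=> k; have [] := fP (k, u k) (uG k).
exists d; split.
- by apply: fixed_lim ud => n; case: (uG n).
- by apply: cle_lim ud => n; case: (uG n).
- move=> e e0.
  have hh k : hs k.+1 <= hs k / 2 by rewrite /hs exprSr.
  have [n hn] := filter_ex (halving_near e0 hh).
  have [_ _ _ [v vP]] := fP (n, u n) (uG n).
  by exists v; apply: le_trans (vP _ (d_near n.+1)) hn.
Qed.

(** Being below the positive a makes d positive, and the invariance clause of [pos_sqrt] makes its
    root fixed. This root witnesses positivity inside the fixed point algebra. *)
Lemma fixed_square_representative (Ad : invertibles_dense A) : pos a ->
  exists k, [/\ star k = k, fixed k, cle (k * k) a & cle a (k * k)].
Proof.
move=> ap; have [d [df da ad]] := fixed_representative Ad.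
have [k [ks dE _ kphi]] := pos_sqrt (cle_pos ap da).
exists k; split; rewrite -?dE// => g.
by apply: kphi => //; exact: fixed1.
Qed.

End Comparable.

End RokhlinSurjectivity.

(** * Matrix amplification of the action *)

Section MatrixAction.
Context {R : realType}.

Section MatrixHom.
Context {A B : unitalCStarAlgType R} (phi : starHom A B) (n : nat).

Definition mx_hom (x : mxalg A n) : mxalg B n := map_mx phi (x : 'M[A]_n).

Fact mx_hom_linear : linear mx_hom.
Proof. by move=> c x y; apply/matrixP => i j; rewrite !mxE linearP. Qed.

Lemma map_mxM_hom m p q (x : 'M[A]_(m, p)) (y : 'M[A]_(p, q)) :
  map_mx phi (x *m y) = map_mx phi x *m map_mx phi y.
Proof.
apply/matrixP => i j; rewrite !mxE raddf_sum; apply: eq_bigr => k _.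
by rewrite !mxE /= starhomM.
Qed.

Lemma map_mxstar_hom m p (x : 'M[A]_(m, p)) :
  map_mx phi (mxstar x) = mxstar (map_mx phi x).
Proof. by apply/matrixP => i j; rewrite !mxE starhomS. Qed.

Fact mx_homM x y : mx_hom (x * y) = mx_hom x * mx_hom y.
Proof. exact: map_mxM_hom. Qed.

Fact mx_homS x : mx_hom (star x) = star (mx_hom x).
Proof. exact: map_mxstar_hom. Qed.

Definition mx_starHom : starHom (mxalg A n) (mxalg B n) :=
  StarHom mx_hom_linear mx_homM mx_homS.

End MatrixHom.

Context {gT : finGroupType} {A : unitalCStarAlgType R}.
Variable (alpha : cstarAction gT A) (n : nat).

Fact mx_action1 (x : mxalg A n) : mx_starHom (alpha 1%g) n x = x.
Proof. by apply/matrixP => i j; rewrite !mxE action1. Qed.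

Fact mx_actionM g h (x : mxalg A n) : mx_starHom (alpha (g * h)%g) n x =
  mx_starHom (alpha g) n (mx_starHom (alpha h) n x).
Proof. by apply/matrixP => i j; rewrite !mxE actionM. Qed.

Definition mx_action : cstarAction gT (mxalg A n) :=
  CStarAction mx_action1 mx_actionM.

Lemma entry_norm_le m p (x : 'M[A]_(m, p)) (r : R) :
  (forall i j, cnorm (x i j) <= r) -> entry_norm x <= (m * p)%:R * r.
Proof.
move=> xr; apply: (@le_trans _ _ (\sum_(i < m) \sum_(j < p) r)).
  by apply: ler_sum => i _; apply: ler_sum => j _.
by rewrite !sumr_const !card_ord -mulrnA -[leLHS]mulr_natl mulnC.
Qed.

Lemma mxalg_cnorm_lt (x : mxalg A n) (r : R) : 0 < r ->
  (forall i j, cnorm ((x : 'M[A]_n) i j) <= r / (n * n).+1%:R) -> cnorm x < r.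
Proof.
move=> r0 xr; rewrite mxalg_cnormE (le_lt_trans (mxnorm_le_entry _))//.
apply: le_lt_trans (entry_norm_le xr) _.
by rewrite mulrCA gtr_pMr// ltr_pdivrMr// mul1r ltr_nat.
Qed.

(** The scalar matrices e_g 1_n form a tower when the e_g are chosen for the finitely many entries
    of matrices in F: their commutators with a matrix are computed entry by entry. *)
Lemma mx_rokhlin : rokhlin_property alpha -> rokhlin_property mx_action.
Proof.
move=> alphaR F r Ffin r0.
pose F' := [set (p.1 : 'M[A]_n) p.2.1 p.2.2 |
  p in F `*` [set: ('I_n * 'I_n)%type]].
have F'fin : finite_set F'.
  by apply: finite_image; apply: finite_setX => //; exact: finite_finset.
pose r1 := r / (n * n).+1%:R; have r10 : 0 < r1 by rewrite divr_gt0.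
have [e [e1 e2 e3 e4 e5]] := alphaR F' r1 F'fin r10.
exists (fun g => (e g)%:M : 'M[A]_n); split.
- move=> g; have [es ee] := e1 g; split; last by rewrite mxalg_mulE -scalar_mxM ee.
  apply/matrixP => i j; rewrite !mxE eq_sym.
  by case: eqP => _; rewrite ?mulr1n ?mulr0n ?es ?star0.
- move=> g h gh; rewrite mxalg_mulE -scalar_mxM e2//.
  by apply/matrixP => i j; rewrite !mxE mul0rn.
- move=> g h; apply: mxalg_cnorm_lt => // i j; rewrite !mxE.
  case: eqP => _; rewrite ?mulr1n ?mulr0n; first exact/ltW/e3.
  by rewrite raddf0 subr0 cnorm0 ltW.
- move=> g x Fx; apply: mxalg_cnorm_lt => // i j.
  have -> : (((e g)%:M * x - x * (e g)%:M : mxalg A n) : 'M[A]_n) i j =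
      e g * (x : 'M[A]_n) i j - (x : 'M[A]_n) i j * e g.
    rewrite !mxE (bigD1 i)//= [in X in _ - X](bigD1 j)//= !mxE !eqxx !mulr1n.
    rewrite !big1 ?addr0// => k; first by move=> kj; rewrite mxE (negbTE kj) mulr0.
    by rewrite eq_sym => /negbTE ki; rewrite mxE ki mul0r.
  by apply/ltW/e4; exists (x, (i, j)).
- apply/matrixP => i j; rewrite summxE mxE -e5.
  have [<-|ij] := eqVneq i j.
    by rewrite mulr1n; apply: eq_bigr => g _; rewrite mxE eqxx.
  by rewrite mulr0n big1// => g _; rewrite mxE (negbTE ij).
Qed.

End MatrixAction.

(** * Density of invertibles in matrix algebras *)

Section Invertibles.
Context {R : realType} {A : unitalCStarAlgType R}.

Lemma stable_rank_one_invertibles : stable_rank_one A -> invertibles_dense A.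
Proof.
move=> sr x r r0; have rC : 0 < r%:C by rewrite ltcR.
have [||y [yx [z [yz zy]]]] := sr (interior (ball x r%:C)).
- by exists x; exact: nbhsx_ballx.
- exact: open_interior.
exists y, z; split => //.
by move: yx => /interior_subset; rewrite -ball_normE /ball_ /= cnormE ltcR => /ltW.
Qed.

(* Schur complement with respect to an invertible perturbation of the upper
   left entry. *)
Lemma mx_invertibles (Ad : invertibles_dense A) n (x : 'M[A]_n) (r : R) : 0 < r ->
  exists y z : 'M[A]_n, [/\ y *m z = 1%:M, z *m y = 1%:M
    & forall i j, cnorm ((x - y) i j) <= r].
Proof.
move=> r0; elim: n x => [|n IH] x.
  by exists 1%:M, 1%:M; split; rewrite ?mulmx1// => -[].
have [p0 [q0 [pq0 qp0 xp]]] := Ad (x 0 0) _ r0.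
rewrite -[n.+1]/(1 + n)%N in x xp *.
pose p : 'M[A]_1 := p0%:M; pose q : 'M[A]_1 := q0%:M.
have pq : p *m q = 1%:M by rewrite -scalar_mxM pq0.
have qp : q *m p = 1%:M by rewrite -scalar_mxM qp0.
pose b := ursubmx x; pose c := dlsubmx x.
have [s [t [st ts xs]]] := IH (drsubmx x - c *m q *m b).
pose L : 'M[A]_(1 + n) := block_mx 1%:M 0 (c *m q) 1%:M.
pose L' : 'M[A]_(1 + n) := block_mx 1%:M 0 (- (c *m q)) 1%:M.
pose U : 'M[A]_(1 + n) := block_mx p b 0 s.
pose U' : 'M[A]_(1 + n) := block_mx q (- (q *m b *m t)) 0 t.
have LL' : L *m L' = 1%:M.
  rewrite mulmx_block !mulmx1 !mul1mx !mul0mx !mulmx0 !addr0 add0r subrr.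
  by rewrite -scalar_mx_block.
have L'L : L' *m L = 1%:M.
  rewrite mulmx_block !mulmx1 !mul1mx !mul0mx !mulmx0 !addr0 add0r addNr.
  by rewrite -scalar_mx_block.
have UU' : U *m U' = 1%:M.
  rewrite mulmx_block pq st !mul0mx !mulmx0 !addr0 !add0r mulmxN !mulmxA pq.
  by rewrite mul1mx addNr -scalar_mx_block.
have U'U : U' *m U = 1%:M.
  rewrite mulmx_block qp ts !mul0mx !mulmx0 !addr0 !add0r mulNmx -!mulmxA ts.
  by rewrite mulmx1 subrr -scalar_mx_block.
exists (L *m U), (U' *m L'); split.
- by rewrite mulmxA -[L *m U *m U']mulmxA UU' mulmx1.
- by rewrite mulmxA -[U' *m L' *m L]mulmxA L'L mulmx1.
(* The off-diagonal blocks of L U are exactly b and c q p = c, so only the two diagonal blocks are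
   perturbed: the first by the choice of p0, the second by induction. *)
have -> : x - L *m U = block_mx (ulsubmx x - p) 0 0 (drsubmx x - c *m q *m b - s).
  rewrite mulmx_block !mul1mx !mul0mx !addr0 -[c *m q *m p]mulmxA qp mulmx1.
  by rewrite -{1}[x]submxK opp_block_mx add_block_mx -/b -/c !subrr opprD addrA.
move=> k l; case: (split_ordP k) => k' ->; case: (split_ordP l) => l' ->.
- rewrite block_mxEul !mxE !ord1 eqxx mulr1n.
  by rewrite (_ : lshift n 0 = 0)//; exact: val_inj.
- by rewrite block_mxEur mxE cnorm0 ltW.
- by rewrite block_mxEdl mxE cnorm0 ltW.
- by rewrite block_mxEdr.
Qed.

Lemma mxalg_invertibles n : invertibles_dense A -> invertibles_dense (mxalg A n).
Proof.
move=> Ad x r r0; have r10 : 0 < r / (n * n).+1%:R by rewrite divr_gt0.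
have [y [z [yz zy xy]]] := mx_invertibles Ad (x : 'M[A]_n) r10.
exists y, z; split => //.
exact/ltW/mxalg_cnorm_lt.
Qed.

End Invertibles.

(** * From matrices to the Cuntz semigroup *)

Section RectangularComparison.
Context {R : realType} {B : unitalCStarAlgType R}.

(* Cuntz comparison of matrices of different sizes, without padding. *)
Definition mxcle m n (a : 'M[B]_m) (b : 'M[B]_n) := forall r : R, 0 < r ->
  exists v : 'M[B]_(m, n), entry_norm (v *m b *m mxstar v - a) <= r.

Lemma mxstar_block m1 m2 n1 n2 (a : 'M[B]_(m1, n1)) b c (d : 'M[B]_(m2, n2)) :
  mxstar (block_mx a b c d) = block_mx (mxstar a) (mxstar c) (mxstar b) (mxstar d).
Proof. by rewrite /mxstar map_block_mx tr_block_mx. Qed.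

Lemma mxstar1 n : mxstar (1%:M : 'M[B]_n) = 1%:M.
Proof.
apply/matrixP => i j; rewrite !mxE eq_sym.
by case: eqP => _; rewrite ?mulr1n ?mulr0n ?star1 ?star0.
Qed.

Lemma mxstar0 m n : mxstar (0 : 'M[B]_(m, n)) = 0.
Proof. by apply/matrixP => i j; rewrite !mxE star0. Qed.

Lemma entry_norm0 m n : entry_norm (0 : 'M[B]_(m, n)) = 0.
Proof. by rewrite /entry_norm big1// => i _; rewrite big1// => j _; rewrite mxE cnorm0. Qed.

Lemma mxcle_refl n (a : 'M[B]_n) : mxcle a a.
Proof.
move=> r r0; exists 1%:M.
by rewrite mul1mx mxstar1 mulmx1 subrr entry_norm0 ltW.
Qed.

Lemma mxcle_trans m n p (a : 'M[B]_m) (b : 'M[B]_n) (c : 'M[B]_p) :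
  mxcle a b -> mxcle b c -> mxcle a c.
Proof.
move=> ab bc r r0; have r20 : 0 < r / 2 by lra.
have [v vb] := ab _ r20; set V := entry_norm v ^+ 2 + 1.
have V0 : 0 < V by have := sqr_ge0 (entry_norm v); rewrite /V; lra.
have [w wc] := bc _ (divr_gt0 r20 V0); exists (v *m w).
have -> : v *m w *m c *m mxstar (v *m w) - a =
    v *m (w *m c *m mxstar w - b) *m mxstar v + (v *m b *m mxstar v - a).
  by rewrite mxstarM mulmxBr mulmxBl addrA subrK !mulmxA.
apply: le_trans (entry_normD _ _) _; move: wc; rewrite ler_pdivlMr// => wc.
set d := w *m c *m mxstar w - b in wc *.
have h1 := entry_normM (v *m d) (mxstar v); have h2 := entry_normM v d.
rewrite entry_norm_star in h1; have := entry_norm_ge0 v; have := entry_norm_ge0 d.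
have h3 : entry_norm (v *m d) * entry_norm v <= entry_norm v * entry_norm d * entry_norm v.
  by rewrite ler_wpM2r// entry_norm_ge0.
by move: wc h1 h3; rewrite /V expr2 mulrDr mulr1; lra.
Qed.

Lemma entry_norm_block m1 m2 n1 n2 (a : 'M[B]_(m1, n1)) (b : 'M[B]_(m1, n2))
    (c : 'M[B]_(m2, n1)) (d : 'M[B]_(m2, n2)) :
  entry_norm (block_mx a b c d) =
  (entry_norm a + entry_norm b) + (entry_norm c + entry_norm d).
Proof.
rewrite /entry_norm big_split_ord -!big_split; congr (_ + _).
  apply: eq_bigr => i _; rewrite big_split_ord; congr (_ + _);
  by apply: eq_bigr => j _; rewrite ?block_mxEul ?block_mxEur.
apply: eq_bigr => i _; rewrite big_split_ord; congr (_ + _);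
by apply: eq_bigr => j _; rewrite ?block_mxEdl ?block_mxEdr.
Qed.

Lemma block_conj m1 m2 n1 n2 (v : 'M[B]_(m1, n1)) (w : 'M[B]_(m2, n2)) a b a' b' :
  block_mx v 0 0 w *m block_mx a 0 0 b *m mxstar (block_mx v 0 0 w) - block_mx a' 0 0 b' =
  block_mx (v *m a *m mxstar v - a') 0 0 (w *m b *m mxstar w - b').
Proof.
rewrite mxstar_block !mulmx_block !mxstar0 !(mulmx0, mul0mx, addr0, add0r).
by rewrite opp_block_mx add_block_mx !subr0.
Qed.

Lemma mxcle_block m1 m2 n1 n2 (a : 'M[B]_m1) (b : 'M[B]_m2) (a' : 'M[B]_n1)
    (b' : 'M[B]_n2) : mxcle a a' -> mxcle b b' ->
  mxcle (block_mx a 0 0 b) (block_mx a' 0 0 b').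
Proof.
move=> aa bb r r0; have r20 : 0 < r / 2 by lra.
have [v va] := aa _ r20; have [w wb] := bb _ r20.
exists (block_mx v 0 0 w); rewrite block_conj entry_norm_block !entry_norm0.
by lra.
Qed.

Lemma entry_norm_le_div m n (x : 'M[B]_(m, n)) (r : R) : 0 < r ->
  (forall i j, cnorm (x i j) <= r / (m * n).+1%:R) -> entry_norm x <= r.
Proof.
move=> r0 /entry_norm_le/le_trans; apply.
by rewrite mulrCA ler_piMr ?ltW// ltr_pdivrMr// mul1r ltr_nat.
Qed.

Lemma mxcle_cle n (a b : mxalg B n) :
  mxcle (a : 'M[B]_n) (b : 'M[B]_n) <-> cle a b.
Proof.
split=> ab r r0.
  have [v vb] := ab _ r0; exists (v : mxalg B n); rewrite mxalg_cnormE.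
  exact: le_trans (mxnorm_le_entry _) vb.
have r10 : 0 < r / (n * n).+1%:R by rewrite divr_gt0.
have [v vb] := ab _ r10; exists (v : 'M[B]_n).
move: vb; rewrite mxalg_cnormE => vb.
apply: entry_norm_le_div => // i j.
exact: le_trans (cnorm_entry_mxnorm _ i j) vb.
Qed.

Lemma sum_ord_trunc (V : nmodType) K N (F : nat -> V) : (K <= N)%N ->
  (forall k, (K <= k)%N -> F k = 0) -> \sum_(k < N) F k = \sum_(k < K) F k.
Proof.
move=> KN F0; rewrite -(subnKC KN) big_split_ord/= [X in _ + X]big1 ?addr0//.
by move=> k _; rewrite F0// leq_addr.
Qed.

Implicit Types x y v : minf B.

Lemma minf_entryE x (i j : 'I_(msize x)) : minf_entry x i j = mval x i j.
Proof. by rewrite /minf_entry !valK. Qed.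

Lemma minf_entry0 x i j : (msize x <= i)%N || (msize x <= j)%N -> minf_entry x i j = 0.
Proof.
rewrite /minf_entry => /orP[]; rewrite leqNgt => h; first by rewrite insubN.
by rewrite [insub j]insubN//; case: insub.
Qed.

Lemma minf_entry_mx N (M : 'M[B]_N) i j (iN : (i < N)%N) (jN : (j < N)%N) :
  minf_entry (MInf M) i j = M (Ordinal iN) (Ordinal jN).
Proof. exact: (@minf_entryE (MInf M) (Ordinal iN) (Ordinal jN)). Qed.

Lemma minf_entry_norm x i j : cnorm (minf_entry x i j) <= minf_norm x.
Proof.
have [iN|iN] := ltnP i (msize x); last by rewrite minf_entry0 ?iN// cnorm0 mxnorm_ge0.
have [jN|jN] := ltnP j (msize x); last by rewrite minf_entry0 ?jN ?orbT// cnorm0 mxnorm_ge0.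
rewrite -[X in minf_entry _ X _]/(val (Ordinal iN)).
rewrite -[X in minf_entry _ _ X]/(val (Ordinal jN)) minf_entryE.
exact: cnorm_entry_mxnorm.
Qed.

Lemma minf_entry_sub x y i j :
  minf_entry (minf_sub x y) i j = minf_entry x i j - minf_entry y i j.
Proof.
rewrite /minf_sub; set N := maxn _ _.
have [iN|iN] := ltnP i N; last first.
  by rewrite !minf_entry0 ?subr0// (leq_trans _ iN)// ?leq_maxr ?leq_maxl.
have [jN|jN] := ltnP j N; last first.
  by rewrite !minf_entry0 ?subr0// (leq_trans _ jN)// ?leq_maxr ?leq_maxl// orbT.
by rewrite minf_entry_mx !mxE.
Qed.

Lemma minf_entry_star x i j : minf_entry (minf_star x) i j = star (minf_entry x j i).
Proof.
have [iN|iN] := ltnP i (msize x); last by rewrite !minf_entry0 ?star0// iN ?orbT.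
have [jN|jN] := ltnP j (msize x); last by rewrite !minf_entry0 ?star0// jN ?orbT.
rewrite /minf_star minf_entry_mx !mxE; congr star.
by rewrite -[RHS]/(minf_entry x (Ordinal jN) (Ordinal iN)) minf_entryE.
Qed.

(** The bound K frees the sum from the padded size, so that nested products can all be summed over
    the size of the middle factor. *)
Lemma minf_entry_mul x y K i j : (K <= maxn (msize x) (msize y))%N ->
  (forall k, (K <= k)%N -> minf_entry x i k * minf_entry y k j = 0) ->
  minf_entry (minf_mul x y) i j = \sum_(k < K) minf_entry x i k * minf_entry y k j.
Proof.
move=> KN F0; rewrite -(sum_ord_trunc KN F0) /minf_mul; set N := maxn _ _.
have [iN|iN] := ltnP i N; last first.
  rewrite minf_entry0 ?iN// big1// => k _.
  by rewrite minf_entry0 ?mul0r// (leq_trans _ iN)// leq_maxl.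
have [jN|jN] := ltnP j N; last first.
  rewrite minf_entry0 ?jN ?orbT// big1// => k _.
  by rewrite [minf_entry y _ _]minf_entry0 ?mulr0// (leq_trans _ jN) ?orbT// leq_maxr.
by rewrite minf_entry_mx mxE; apply: eq_bigr => k _; rewrite !mxE.
Qed.

Definition minf_block m n v : 'M[B]_(m, n) := \matrix_(i, j) minf_entry v i j.

Lemma minf_entry_conj v b i j :
  minf_entry (minf_mul (minf_mul v b) (minf_star v)) i j =
  \sum_(l < msize b) (\sum_(k < msize b) minf_entry v i k * minf_entry b k l) *
    star (minf_entry v j l).
Proof.
have E l : minf_entry (minf_mul v b) i l =
    \sum_(k < msize b) minf_entry v i k * minf_entry b k l.
  apply: minf_entry_mul; first exact: leq_maxr.
  by move=> k bk; rewrite [minf_entry b _ _]minf_entry0 ?bk// mulr0.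
rewrite (@minf_entry_mul _ _ (msize b)).
- by apply: eq_bigr => l _; rewrite E minf_entry_star.
- by rewrite (leq_trans (leq_maxr (msize v) _))// leq_maxl.
- move=> l bl; rewrite E big1 ?mul0r// => k _.
  by rewrite [minf_entry b _ _]minf_entry0 ?bl ?orbT// mulr0.
Qed.

Lemma minf_block_conj v a b (i j : 'I_(msize a)) :
  let w := minf_block (msize a) (msize b) v in
  (w *m mval b *m mxstar w - mval a) i j =
  minf_entry (minf_sub (minf_mul (minf_mul v b) (minf_star v)) a) i j.
Proof.
move=> w; rewrite minf_entry_sub minf_entryE minf_entry_conj !mxE; congr (_ - _).
apply: eq_bigr => l _; rewrite !mxE; congr (_ * _).
by apply: eq_bigr => k _; rewrite mxE minf_entryE.
Qed.

(** As b vanishes beyond its size, cutting v to a block of size a by size b leaves the entries of v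
    b v^* - a within the size of a unchanged. Conversely, a rectangular v padded with zeros to a
    square gives a conjugate that vanishes outside that size. *)
Lemma cuntz_leP (a b : minf_pos B) : cuntz_le a b <-> mxcle (mval a) (mval b).
Proof.
split=> [[v vP] r r0|ab].
  have r10 : 0 < r / (msize a * msize a).+1%:R by rewrite divr_gt0.
  have /cvgrPdist_lt/(_ _ r10)/filter_ex[n] := vP.
  rewrite /= sub0r normrN ger0_norm ?mxnorm_ge0// => /ltW vn.
  exists (minf_block _ _ (v n)).
  apply: entry_norm_le_div => // i j; rewrite minf_block_conj.
  exact: le_trans (minf_entry_norm _ _ _) vn.
have /choice[v vP] n : exists v : 'M[B]_(msize a, msize b),
    entry_norm (v *m mval b *m mxstar v - mval a) <= n.+1%:R^-1.
  by apply: ab; rewrite invr_gt0.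
pose w n : minf B := let N := maxn (msize a) (msize b) in
  @MInf _ _ N (\matrix_(i < N, j < N)
    if (insub (i : nat), insub (j : nat)) is (Some i', Some j') then v n i' j' else 0).
have wE n : minf_block (msize a) (msize b) (w n) = v n.
  apply/matrixP => i j; have iN := leq_trans (ltn_ord i) (leq_maxl _ (msize b)).
  have jN := leq_trans (ltn_ord j) (leq_maxr (msize a) _).
  by rewrite mxE (minf_entry_mx _ iN jN) mxE /= !valK.
have w0 n i k : (msize a <= i)%N -> minf_entry (w n) i k = 0.
  move=> ai; have [iN|iN] := ltnP i (msize (w n)); last by rewrite minf_entry0 ?iN.
  have [kN|kN] := ltnP k (msize (w n)); last by rewrite minf_entry0 ?kN ?orbT.
  by rewrite (minf_entry_mx _ iN kN) mxE /= insubN// -leqNgt.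
exists w; apply/cvgrPdist_lt => r r0.
have /cvgrPdist_lt/(_ _ r0) := @cvg_harmonic R.
apply: filterS => n; rewrite !sub0r !normrN !ger0_norm ?harmonic_ge0 ?mxnorm_ge0//.
apply: le_lt_trans; apply: le_trans (mxnorm_le_entry _) (le_trans _ (vP n)).
set X := minf_sub _ _; have aX : (msize a <= msize X)%N := leq_maxr _ _.
have X0 i j : (msize a <= i)%N || (msize a <= j)%N -> minf_entry X i j = 0.
  move=> aij; rewrite minf_entry_sub minf_entry_conj [minf_entry a _ _]minf_entry0// subr0.
  apply: big1 => l _; case/orP: aij => [ai|aj]; last by rewrite w0// star0 mulr0.
  by rewrite big1 ?mul0r// => k _; rewrite w0// mul0r.
pose F (i j : nat) := cnorm (minf_entry X i j).
have -> : entry_norm (mval X) = \sum_(i < msize X) \sum_(j < msize X) F i j.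
  by apply: eq_bigr => i _; apply: eq_bigr => j _; rewrite /F minf_entryE.
rewrite (sum_ord_trunc (F := fun i => \sum_(j < msize X) F i j) aX); last first.
  by move=> i ai; rewrite big1// => j _; rewrite /F X0 ?ai// cnorm0.
apply: ler_sum => i _.
rewrite (sum_ord_trunc (F := F i) aX) => [|j aj]; last by rewrite /F X0 ?aj ?orbT// cnorm0.
by apply: ler_sum => j _; rewrite /F -minf_block_conj wE.
Qed.

End RectangularComparison.

Section CuntzSemigroup.
Context {R : realType}.

Section Classes.
Context {B : unitalCStarAlgType R}.
Implicit Types a b c : minf_pos B.

Lemma cuntz_le_refl a : cuntz_le a a.
Proof. exact/cuntz_leP/mxcle_refl. Qed.

Lemma cuntz_le_trans b a c : cuntz_le a b -> cuntz_le b c -> cuntz_le a c.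
Proof. by move=> /cuntz_leP ab /cuntz_leP bc; apply/cuntz_leP/(mxcle_trans ab bc). Qed.

Lemma cuntz_eq_refl a : cuntz_eq a a.
Proof. by split; exact: cuntz_le_refl. Qed.

Lemma cuntz_eq_sym a b : cuntz_eq a b -> cuntz_eq b a.
Proof. by case. Qed.

Lemma cuntz_eq_trans b a c : cuntz_eq a b -> cuntz_eq b c -> cuntz_eq a c.
Proof.
by move=> [ab ba] [bc cb]; split; [apply: cuntz_le_trans ab bc|apply: cuntz_le_trans cb ba].
Qed.

Lemma cuntz_classP a b : cuntz_class a = cuntz_class b <-> cuntz_eq a b.
Proof.
split=> ab.
  by have : cuntz_class b b by [exact: cuntz_eq_refl]; rewrite -ab.
apply/seteqP; split=> c; apply: cuntz_eq_trans => //; exact: cuntz_eq_sym.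
Qed.

(** Different constructions of one matrix carry different proofs of positivity; passing to Cuntz
    equivalence makes that difference harmless. *)
Lemma cuntz_eq_mval m (x y : 'M[B]_m) (xp : mxpositive (mval (MInf x)))
  (yp : mxpositive (mval (MInf y))) : x = y ->
  cuntz_eq (MInfPos xp) (MInfPos yp).
Proof.
by move=> xy; split; apply/cuntz_leP; rewrite /= xy; exact: mxcle_refl.
Qed.

Lemma Wle_class a b : Wle (cuntz_class a) (cuntz_class b) <-> cuntz_le a b.
Proof.
split=> [[a' [b' [[aa' _] [_ b'b] ab]]]|ab].
  exact: cuntz_le_trans aa' (cuntz_le_trans ab b'b).
by exists a, b; split=> //; exact: cuntz_eq_refl.
Qed.

Lemma pos_sum_le a b a' b' : cuntz_le a a' -> cuntz_le b b' ->
  cuntz_le (pos_sum a b) (pos_sum a' b').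
Proof. by move=> /cuntz_leP aa' /cuntz_leP bb'; apply/cuntz_leP/mxcle_block. Qed.

Lemma Wadd_class a b :
  Wadd (cuntz_class a) (cuntz_class b) = cuntz_class (pos_sum a b).
Proof.
apply/seteqP; split=> c => [[a' [b' [[aa' a'a] [bb' b'b] abc]]]|abc].
  by apply: cuntz_eq_trans abc; split; exact: pos_sum_le.
by exists a, b; split=> //; exact: cuntz_eq_refl.
Qed.

End Classes.

Section Functoriality.
Context {A B : unitalCStarAlgType R} (phi : starHom A B).

Lemma entry_norm_hom m n (x : 'M[A]_(m, n)) :
  entry_norm (map_mx phi x) <= 2 * entry_norm x.
Proof.
rewrite /entry_norm mulr_sumr ler_sum// => i _; rewrite mulr_sumr ler_sum// => j _.
by rewrite mxE starhom_bounded.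
Qed.

Lemma map_conj_hom m n (v : 'M[A]_(m, n)) (b : 'M[A]_n) (a : 'M[A]_m) :
  map_mx phi (v *m b *m mxstar v - a) =
  map_mx phi v *m map_mx phi b *m mxstar (map_mx phi v) - map_mx phi a.
Proof. by rewrite map_mxB !map_mxM_hom map_mxstar_hom. Qed.

Lemma mxcle_hom m n (a : 'M[A]_m) (b : 'M[A]_n) :
  mxcle a b -> mxcle (map_mx phi a) (map_mx phi b).
Proof.
move=> ab r r0; have r20 : 0 < r / 2 by lra.
have [v vb] := ab _ r20; exists (map_mx phi v); rewrite -map_conj_hom.
by have := entry_norm_hom (v *m b *m mxstar v - a); lra.
Qed.

Lemma pos_map_le (a b : minf_pos A) :
  cuntz_le a b -> cuntz_le (pos_map phi a) (pos_map phi b).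
Proof. by move=> /cuntz_leP ab; apply/cuntz_leP/mxcle_hom. Qed.

Lemma Wmap_class (a : minf_pos A) : Wmap phi (cuntz_class a) = cuntz_class (pos_map phi a).
Proof.
apply/seteqP; split=> c => [[a' [[aa' a'a] a'c]]|ac].
  by apply: cuntz_eq_trans a'c; split; exact: pos_map_le.
by exists a; split=> //; exact: cuntz_eq_refl.
Qed.

End Functoriality.

(** * Matrices over the fixed point algebra *)

Section FixedMatrices.
Context {gT : finGroupType} {A : unitalCStarAlgType R}.
Variable alpha : cstarAction gT A.
Local Notation iota := (fixed_incl alpha).

Lemma fixed_mx_lift m n (x : 'M[A]_(m, n)) : (forall g, map_mx (alpha g) x = x) ->
  exists y : 'M[fixedAlg alpha]_(m, n), x = map_mx iota y.
Proof.
move=> xf; have xij i j : x i j \in fixed_pred alpha.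
  by apply/fixedP => g; rewrite -{2}(xf g) mxE.
by exists (\matrix_(i, j) FixedAlg (xij i j)); apply/matrixP => i j; rewrite !mxE.
Qed.

Lemma map_fixed_mx m n (y : 'M[fixedAlg alpha]_(m, n)) g :
  map_mx (alpha g) (map_mx iota y) = map_mx iota y.
Proof.
apply/matrixP => i j; rewrite !mxE /=.
by have /fixedP := valP (y i j); exact.
Qed.

Lemma entry_norm_incl m n (y : 'M[fixedAlg alpha]_(m, n)) :
  entry_norm (map_mx iota y) = entry_norm y.
Proof. by apply: eq_bigr => i _; apply: eq_bigr => j _; rewrite mxE. Qed.

(** Placing a and b in opposite corners of the square matrices of size m + n turns a rectangular v
    into an upper right corner. [cle_fixed] then applies in that algebra, and the upper right block
    of the fixed V is the desired rectangular conjugator. *)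
Lemma mxcle_fixed (alphaR : rokhlin_property alpha) m n
    (a : 'M[fixedAlg alpha]_m) (b : 'M[fixedAlg alpha]_n) :
  mxcle (map_mx iota a) (map_mx iota b) -> mxcle a b.
Proof.
set a' := map_mx iota a; set b' := map_mx iota b => ab r r0.
pose A1 : mxalg A (m + n) := block_mx a' 0 0 0.
pose B1 : mxalg A (m + n) := block_mx 0 0 0 b'.
have fix_block (x : 'M[A]_m) (y : 'M[A]_n) : (forall g, map_mx (alpha g) x = x) ->
    (forall g, map_mx (alpha g) y = y) ->
    fixed (mx_action alpha (m + n)) (block_mx x 0 0 y).
  move=> xf yf g; rewrite /= /mx_hom map_block_mx xf yf.
  by congr block_mx; apply/matrixP => i j; rewrite !mxE raddf0.
have z0 p q g : map_mx (alpha g) (0 : 'M[A]_(p, q)) = 0.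
  by apply/matrixP => i j; rewrite !mxE raddf0.
have A1f : fixed (mx_action alpha (m + n)) A1.
  by apply: fix_block => g; [exact: map_fixed_mx|exact: z0].
have B1f : fixed (mx_action alpha (m + n)) B1.
  by apply: fix_block => g; [exact: z0|exact: map_fixed_mx].
have AB : cle A1 B1.
  apply/mxcle_cle => s s0; have [v vb] := ab _ s0.
  exists (block_mx 0 v 0 0); rewrite mxstar_block !mulmx_block !mxstar0.
  rewrite !(mulmx0, mul0mx, addr0, add0r) opp_block_mx add_block_mx !subr0.
  by rewrite entry_norm_block !entry_norm0 !addr0.
have r10 : 0 < r / (m * m).+1%:R by rewrite divr_gt0.
have [V Vf VB] := cle_fixed (mx_rokhlin (n := m + n) alphaR) A1f B1f AB r10.
have [v vE] : exists v : 'M[fixedAlg alpha]_(m, n),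
    ursubmx (V : 'M[A]_(m + n)) = map_mx iota v.
  apply: fixed_mx_lift => g; rewrite map_ursubmx; congr ursubmx; exact: (Vf g).
exists v; rewrite -entry_norm_incl map_conj_hom -vE.
apply: entry_norm_le_div => // i j.
rewrite mxalg_cnormE in VB.
have := le_trans (cnorm_entry_mxnorm _ (lshift n i) (lshift n j)) VB.
suff UE (U : 'M[A]_(m + n)) : ursubmx U *m b' *m mxstar (ursubmx U) - a' =
    ulsubmx (U *m block_mx 0 0 0 b' *m mxstar U - block_mx a' 0 0 0).
  by rewrite UE !mxE.
rewrite -[in RHS](submxK U) mxstar_block !mulmx_block.
rewrite !(mulmx0, mul0mx, addr0, add0r) opp_block_mx add_block_mx.
by rewrite block_mxKul.
Qed.

(** The fixed root k is self-adjoint, so k^2 is k^* k and is positive over the fixed point algebra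
    itself. *)
Lemma mxcle_fixed_representative (alphaR : rokhlin_property alpha)
    (Ad : invertibles_dense A) n (x : 'M[A]_n) : let a := mxstar x *m x in
  (forall g, mxcle (map_mx (alpha g) a) a) ->
  exists k : 'M[fixedAlg alpha]_n, let d := map_mx iota (mxstar k *m k) in
    mxcle d a /\ mxcle a d.
Proof.
move=> a aI.
have aI' g : cle (mx_action alpha n g (a : mxalg A n)) (a : mxalg A n).
  by apply/mxcle_cle; exact: aI.
have ap : pos (a : mxalg A n) by exact: (pos_id (x : mxalg A n)).
have [k [ks kf ka ak]] := fixed_square_representative (mx_rokhlin (n := n) alphaR)
  aI' (mxalg_invertibles Ad) ap.
have [k0 kE] : exists k0 : 'M[fixedAlg alpha]_n, (k : 'M[A]_n) = map_mx iota k0.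
  by apply: fixed_mx_lift => g; exact: (kf g).
exists k0; cbv zeta; rewrite map_mxM_hom map_mxstar_hom -kE.
have -> : mxstar (k : 'M[A]_n) = k by exact: ks.
by split; apply/(mxcle_cle (n := n)).
Qed.

End FixedMatrices.

End CuntzSemigroup.

Theorem proposition5p9 (R : realType) (A : unitalCStarAlgType R)
    (gT : finGroupType) (alpha : cstarAction gT A)
    (Asr1 : stable_rank_one A) (alphaR : rokhlin_property alpha) :
  let W_iota := Wmap (fixed_incl alpha) in
  [/\ set_bij (W (fixedAlg alpha)) (Wfixed alpha) W_iota,
      forall x y, W (fixedAlg alpha) x -> W (fixedAlg alpha) y ->
        W_iota (Wadd x y) = Wadd (W_iota x) (W_iota y)
    & forall x y, W (fixedAlg alpha) x -> W (fixedAlg alpha) y ->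
        Wle x y <-> Wle (W_iota x) (W_iota y)].
Proof.
move=> W_iota; pose iota := fixed_incl alpha.
have le_iota a b : cuntz_le (pos_map iota a) (pos_map iota b) <-> cuntz_le a b.
  split; last exact: pos_map_le.
  by move=> /cuntz_leP ab; apply/cuntz_leP/(mxcle_fixed alphaR).
split.
- split.
  + move=> _ [a _ <-]; rewrite /W_iota Wmap_class; split; first by exists (pos_map iota a).
    move=> g; rewrite Wmap_class; apply/cuntz_classP.
    by apply: cuntz_eq_mval; exact: map_fixed_mx.
  + move=> _ _ /set_mem[a _ <-] /set_mem[b _ <-].
    rewrite /W_iota !Wmap_class => /cuntz_classP[ab ba].
    by apply/cuntz_classP; split; apply/le_iota.
  + move=> _ [[a _ <-] aI].
    (* These comparisons, for all g, contain the reverse ones: applying alpha_g to the relation for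
       g^-1 exchanges the two sides. *)
    have {}aI g : mxcle (map_mx (alpha g) (mval a)) (mval a).
      have /cuntz_classP[+ _] : cuntz_class (pos_map (alpha g) a) = cuntz_class a.
        by rewrite -Wmap_class.
      by move/cuntz_leP.
    case: a aI => -[n a] /= [x aE] /= aI; rewrite aE in aI.
    have [k [ka ak]] := mxcle_fixed_representative alphaR
      (stable_rank_one_invertibles Asr1) aI.
    have kp : mxpositive (mval (MInf (mxstar k *m k))) by exists k.
    exists (cuntz_class (MInfPos kp)); first by exists (MInfPos kp).
    rewrite /W_iota Wmap_class; apply/cuntz_classP.
    by split; apply/cuntz_leP; rewrite /= aE.
- move=> _ _ [a _ <-] [b _ <-]; rewrite /W_iota Wadd_class !Wmap_class Wadd_class.
  apply/cuntz_classP/cuntz_eq_mval; rewrite /minf_map/= map_block_mx.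
  by congr block_mx; apply/matrixP => i j; rewrite !mxE.
- move=> _ _ [a _ <-] [b _ <-]; rewrite /W_iota !Wmap_class !Wle_class.
  by split=> /le_iota.
Qed.
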